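(* Let $G$ be a finite digraph with weighted, non-parallel edges. Then $\zeta_G^{-1}$ is a polynomial in the components of $\boldsymbol{t}=(t_{\uparrow\uparrow},t_{\downarrow\downarrow},t_{\uparrow\downarrow},t_{\downarrow\uparrow})$ and $\boldsymbol{u}=(u_\uparrow,u_\downarrow)$, namely $$\zeta_G^{-1}(\boldsymbol{t},\boldsymbol{u})=\det\big(I_{2m_G}-M(\boldsymbol{t},\boldsymbol{u})\big).$$ If $G$ has reciprocal weights, then $$\zeta_G^{-1}(1,1,t_{\uparrow\downarrow},t_{\downarrow\uparrow},u_\uparrow,u_\downarrow)=(1-s_\uparrow s_\downarrow)^{m_G-n_G}\det\Big((1-s_\uparrow s_\downarrow)I_{n_G}-u_\uparrow W_G-u_\downarrow W_G^*-s_\uparrow u_\downarrow D_G^{\mathrm{out}}-s_\downarrow u_\uparrow D_G^{\mathrm{in}}\Big),$$ where $s_\uparrow=u_\uparrow(t_{\uparrow\downarrow}-1)$ and $s_\downarrow=u_\downarrow(t_{\downarrow\uparrow}-1)$; and $$\zeta_G^{-1}(t_{\uparrow\uparrow},1,1,1,u_\uparrow,u_\downarrow)=(1-s)^{l_G^+}(1+s)^{l_G^-}(1-s^2)^{r_G-n_G}\det\Big((1-s^2)I_{n_G}-(1-s^2)(u_\uparrow W_G+u_\downarrow W_G^* )-s\,u_\uparrow D_G^{\mathrm{sym}}-s^2u_\uparrow W_G^{\mathrm{sym}}\Big),$$ where $s=u_\uparrow(t_{\uparrow\uparrow}-1)$, $l_G^{\pm}=\mathrm{tr}(A_G\pm W_G)/2$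 is the number of loops of $G$ with weight $\pm1$, and $r_G=\big(\mathrm{tr}(A_G^2)-\mathrm{tr}(A_G)\big)/2$ is the number of pairs of mutually reverse (non-loop) edges of $G$.
   Context: $G$ has $n_G$ vertices and $m_G$ directed edges; loops are allowed, no two edges have the same tail and the same head, and each edge $e$ carries a weight $w(e)\in\mathbb{C}\setminus\{0\}$. $A_G\in\{0,1\}^{n_G\times n_G}$ is the (unweighted) adjacency matrix; $D_G^{\mathrm{out}}$ and $D_G^{\mathrm{in}}$ are the diagonal matrices of row sums of $A_G$ and of $A_G^T$. $W_G$ is the weighted adjacency matrix, obtained from $A_G$ by replacing each entry $1$ by the weight of the corresponding edge. $A_G^{\mathrm{sym}}$ has entries $[A_G]_{ij}[A_G]_{ji}$, $W_G^{\mathrm{sym}}$ has entries $[A_G^{\mathrm{sym}}]_{ij}[W_G]_{ij}$, and $D_G^{\mathrm{sym}}$ is the diagonal matrix of row sums of $A_G^{\mathrm{sym}}$. For an edge $e=(v,v')$, $v$ is its tail and $v'$ its head. Write $e\rightarrow e'$ if the head of $e$ is the tail of $e'$, and $e\rightleftarrows e'$ if the tail of $e'$ is the head of $e$ and the head of $e'$ is the tail of $e$ (so a loop is reverse to itself). $G$ has reciprocal weights if $w(e')=w(e)^{-1}$ whenever $e,e'$ are edges of $G$ with $e\rightleftarrows e'$ (in particular loops then have weight $\pm1$). $G_\updownarrow$ is the digraph with $2m_G$ edges obtained from $G$ by adding, to each edge $e$ of $G$, a new reverse edge of weight $w(e)^{-1}$ (always added as a new edge, possibly parallel to an existing one). Edges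 of $G$ have direction $\mathrm{dir}(e)=\uparrow$, added edges have $\mathrm{dir}(e)=\downarrow$. $W_G^*$ is the weighted adjacency matrix of the added edges, i.e. $W_G^T$ with its nonzero entries inverted. A circuit in $G_\updownarrow$ is a sequence of edges $\gamma=(e_1,\dots,e_\ell)$, $\ell\ge1$, with $e_i\rightarrow e_{i+1}$ for all $i$, where $e_{\ell+1}=e_1$; its weight is $w(\gamma)=w(e_1)\cdots w(e_\ell)$. A cycle $[\gamma]$ is an equivalence class of circuits under cyclic permutation of edges; it is primitive if none of its representatives is a $k$-fold concatenation of a circuit with itself, $k\ge2$. For $d,d'\in\{\uparrow,\downarrow\}$: $|\gamma|_d=|\{i:\mathrm{dir}(e_i)=d\}|$ and $b_{dd'}(\gamma)=|\{i\in\{1,\dots,\ell\}:\mathrm{dir}(e_i)=d,\ \mathrm{dir}(e_{i+1})=d',\ e_i\rightleftarrows e_{i+1}\}|$. With $\mathcal{P}_{G_\updownarrow}$ the set of primitive cycles in $G_\updownarrow$, the zeta function is given, for sufficiently small $|\boldsymbol{t}|$ and $|\boldsymbol{u}|$ (or as a formal power series in the components of $\boldsymbol u$ with coefficients polynomial in the components of $\boldsymbol t$), by $$\zeta_G(\boldsymbol{t},\boldsymbol{u})=\prod_{[\gamma]\in\mathcal{P}_{G_\updownarrow}}\frac{1}{1-w(\gamma)\,t_{\uparrow\uparrow}^{b_{\uparrow\uparrow}(\gamma)}t_{\downarrow\downarrow}^{b_{\downarrow\downarrow}(\gamma)}t_{\uparrow\downarrow}^{b_{\uparrow\downarrow}(\gamma)}t_{\downarrow\uparrow}^{b_{\downarrow\uparrow}(\gamma)}u_\uparrow^{|\gamma|_\uparrow}u_\downarrow^{|\gamma|_\downarrow}}.$$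 Matrices indexed by the $2m_G$ edges of $G_\updownarrow$: $[B_{dd'}]_{ee'}=w(e)$ if $\mathrm{dir}(e)=d$, $\mathrm{dir}(e')=d'$ and $e\rightleftarrows e'$, and $0$ otherwise; $[C_d]_{ee'}=w(e)$ if $\mathrm{dir}(e)=d$ and $e\rightarrow e'$, and $0$ otherwise; and $$M(\boldsymbol{t},\boldsymbol{u})=u_\uparrow\big(C_\uparrow+(t_{\uparrow\uparrow}-1)B_{\uparrow\uparrow}+(t_{\uparrow\downarrow}-1)B_{\uparrow\downarrow}\big)+u_\downarrow\big(C_\downarrow+(t_{\downarrow\downarrow}-1)B_{\downarrow\downarrow}+(t_{\downarrow\uparrow}-1)B_{\downarrow\uparrow}\big).$$ The determinant formulas with possibly negative exponents are identities of rational functions. *)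

(* Defs.v *)
From HB Require Import structures.
From mathcomp Require Import all_boot all_order all_algebra.
From mathcomp Require Import generic_quotient fraction complex.
From mathcomp Require Import boolp classical_sets reals.
From mathcomp Require Import freeg mpoly.

Set Implicit Arguments.
Unset Strict Implicit.
Unset Printing Implicit Defensive.

Import GRing.Theory.

Local Open Scope ring_scope.
Local Open Scope quotient_scope.

Definition fps (n : nat) (R : comNzRingType) : Type := 'X_{1..n} -> R.

Section FormalPowerSeries.
Variables (n : nat) (R : comNzRingType).
Implicit Types (f g h : fps n R) (p q : {mpoly R[n]}) (m : 'X_{1..n}).

HB.instance Definition _ := gen_eqMixin (fps n R).
HB.instance Definition _ := gen_choiceMixin (fps n R).

Definition fps_of_mpoly p : fps n R := fun m => p@_m.

Definition fps_zero : fps n R := fun _ => 0.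
Definition fps_one : fps n R := fps_of_mpoly 1.
Definition fps_opp f : fps n R := fun m => - f m.
Definition fps_add f g : fps n R := fun m => f m + g m.
(* Cauchy product; the bounds only make the index type of the sum finite *)
Definition fps_mul f g : fps n R := fun m =>
  \sum_(k : 'X_{1..n < (mdeg m).+1, (mdeg m).+1} | m == (k.1 + k.2)%MM)
    f k.1 * g k.2.

Fact fps_addA : associative fps_add.
Proof. by move=> f g h; apply/funext => m; rewrite /fps_add addrA. Qed.
Fact fps_addC : commutative fps_add.
Proof. by move=> f g; apply/funext => m; rewrite /fps_add addrC. Qed.
Fact fps_add0 : left_id fps_zero fps_add.
Proof. by move=> f; apply/funext => m; rewrite /fps_add add0r. Qed.
Fact fps_addN : left_inverse fps_zero fps_opp fps_add.
Proof. by move=> f; apply/funext => m; rewrite /fps_add addNr. Qed.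

HB.instance Definition _ := GRing.isZmodule.Build (fps n R)
  fps_addA fps_addC fps_add0 fps_addN.

Definition fps_trunc d f : {mpoly R[n]} :=
  \sum_(m : 'X_{1..n < d}) f m *: 'X_[m].

Lemma fps_truncE d f m : (mdeg m < d)%N -> (fps_trunc d f)@_m = f m.
Proof.
move=> lt_md; rewrite /fps_trunc raddf_sum /= (bigD1 (BMultinom lt_md)) //=.
rewrite mcoeffZ mcoeffX eqxx mulr1 big1 ?addr0 // => i ne_i.
by rewrite mcoeffZ mcoeffX -[i == m :> 'X_{1..n}]/(i == BMultinom lt_md)
           (negPf ne_i) mulr0.
Qed.

Lemma fps_mul_mcoeff f g p q m :
    (forall k, (mdeg k <= mdeg m)%N -> f k = p@_k) ->
    (forall k, (mdeg k <= mdeg m)%N -> g k = q@_k) ->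
  fps_mul f g m = (p * q)@_m.
Proof.
move=> fp gq; rewrite mcoeffM; apply: eq_bigr => k _.
by rewrite fp ?gq // -ltnS bmdeg.
Qed.

Lemma fps_mulE d f g m : (mdeg m < d)%N ->
  fps_mul f g m = (fps_trunc d f * fps_trunc d g)@_m.
Proof.
by move=> lt_md; apply: fps_mul_mcoeff => k le_km;
   rewrite fps_truncE // (leq_ltn_trans le_km).
Qed.

Fact fps_mulA : associative fps_mul.
Proof.
move=> f g h; apply/funext => m; pose T := fps_trunc (mdeg m).+1.
rewrite (@fps_mul_mcoeff _ _ (T f) (T g * T h)) ?mulrA; first last.
- by move=> k le_km; rewrite -fps_mulE.
- by move=> k le_km; rewrite fps_truncE.
symmetry; apply: fps_mul_mcoeff => k le_km; first by rewrite -fps_mulE.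
by rewrite fps_truncE.
Qed.

Fact fps_mulC : commutative fps_mul.
Proof.
by move=> f g; apply/funext => m; rewrite !(@fps_mulE (mdeg m).+1) // mulrC.
Qed.

Fact fps_mul1 : left_id fps_one fps_mul.
Proof.
move=> f; apply/funext => m.
rewrite (@fps_mul_mcoeff _ _ 1 (fps_trunc (mdeg m).+1 f)) //; last first.
  by move=> k le_km; rewrite fps_truncE.
by rewrite mul1r fps_truncE.
Qed.

Fact fps_mulDl : left_distributive fps_mul fps_add.
Proof.
move=> f g h; apply/funext => m; rewrite /fps_mul /fps_add -big_split /=.
by apply: eq_bigr => k _; rewrite mulrDl.
Qed.

Fact fps_one_neq0 : fps_one != 0.
Proof.
apply/eqP => /(congr1 (fun f : fps n R => f 0%MM)) /eqP.
by rewrite /fps_one /fps_of_mpoly mcoeff1 eqxx oner_eq0.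
Qed.

HB.instance Definition _ := GRing.Zmodule_isComNzRing.Build (fps n R)
  fps_mulA fps_mulC fps_mul1 fps_mulDl fps_one_neq0.

Definition fps_unit : pred (fps n R) := fun f => `[< exists g, g * f = 1 >].
Definition fps_inv f : fps n R :=
  if pselect (exists g, g * f = 1) is left ex then projT1 (cid ex) else f.

Fact fps_mulVf : {in fps_unit, left_inverse 1 fps_inv *%R}.
Proof.
move=> f /asboolP ex_g; rewrite /fps_inv.
by case: pselect => // ex; case: (cid ex).
Qed.
Fact fps_unitP f g : g * f = 1 -> fps_unit f.
Proof. by move=> gf1; apply/asboolP; exists g. Qed.
Fact fps_inv_out : {in [predC fps_unit], fps_inv =1 id}.
Proof.
move=> f /asboolP no_g; rewrite /fps_inv.
by case: pselect => // ex; case: no_g.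
Qed.

HB.instance Definition _ := GRing.ComNzRing_hasMulInverse.Build (fps n R)
  fps_mulVf fps_unitP fps_inv_out.

(* [z] is the product of the [F i], [P i]: on every monomial the coefficients
   of the finite partial products are eventually constant, along the directed
   set of finite subsets of [P], with value that of [z]. *)
Definition has_fps_prod (I : eqType) (P : set I) (F : I -> fps n R)
    (z : fps n R) : Prop :=
  forall m, exists2 S0 : seq I, (forall i, i \in S0 -> P i) &
    forall S : seq I, uniq S -> (forall i, i \in S -> P i) ->
      {subset S0 <= S} -> (\prod_(i <- S) F i : fps n R) m = z m.

(* 0 if the product does not converge *)
Definition fps_prod (I : eqType) (P : set I) (F : I -> fps n R) : fps n R :=
  xget (0 : fps n R) [set z : fps n R | has_fps_prod P F z]%classic.

Lemma has_fps_prod_unique (I : eqType) (P : set I) (F : I -> fps n R) z z' :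
  has_fps_prod P F z -> has_fps_prod P F z' -> z = z'.
Proof.
move=> Fz Fz'; apply/funext => m.
have [S0 PS0 eqS0] := Fz m; have [S1 PS1 eqS1] := Fz' m.
pose S := undup (S0 ++ S1).
have PS i : i \in S -> P i.
  by rewrite mem_undup mem_cat => /orP[/PS0|/PS1].
rewrite -(eqS0 S) ?undup_uniq // => [|i i0].
  by rewrite (eqS1 S) ?undup_uniq // => i i1; rewrite mem_undup mem_cat i1 orbT.
by rewrite mem_undup mem_cat i0.
Qed.

End FormalPowerSeries.

Record wdigraph (K : fieldType) := WDigraph {
  nvert : nat;
  edge : finType;
  tail : edge -> 'I_nvert;
  head : edge -> 'I_nvert;
  wt : edge -> K;
  wt_neq0 : forall e, wt e != 0 }.

Section Digraph.
Variables (K : fieldType) (G : wdigraph K).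
Implicit Types (e : edge G) (g : seq (edge G)).

Definition nedge : nat := #|edge G|.

Definition nonparallel : Prop := injective (fun e => (tail e, head e)).

Definition follows e e' : bool := head e == tail e'.
Definition reverse e e' : bool := (tail e' == head e) && (head e' == tail e).

Definition reciprocal : Prop :=
  forall e e', reverse e e' -> wt e' = (wt e)^-1.

Definition mxA : 'M[K]_(nvert G) :=
  \matrix_(i, j) [exists e, (tail e == i) && (head e == j)]%:R.
(* at most one term in each sum when G has no parallel edges *)
Definition mxW : 'M[K]_(nvert G) :=
  \matrix_(i, j) \sum_(e | (tail e == i) && (head e == j)) wt e.
(* weights of the added reverse edges: transpose of mxW, nonzero entries
   inverted *)
Definition mxWstar : 'M[K]_(nvert G) :=
  \matrix_(i, j) \sum_(e | (head e == i) && (tail e == j)) (wt e)^-1.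
Definition rowsum_mx (A : 'M[K]_(nvert G)) : 'M[K]_(nvert G) :=
  diag_mx (\row_i \sum_j A i j).
Definition mxDout := rowsum_mx mxA.
Definition mxDin := rowsum_mx mxA^T.
Definition mxAsym : 'M[K]_(nvert G) := \matrix_(i, j) (mxA i j * mxA j i).
Definition mxWsym : 'M[K]_(nvert G) := \matrix_(i, j) (mxAsym i j * mxW i j).
Definition mxDsym := rowsum_mx mxAsym.

Definition nloop (c : K) : nat :=
  #|[set e : edge G | (tail e == head e) && (wt e == c)]|.
Definition nrecip : nat :=
  #|[set [set p.1; p.2] | p : edge G * edge G
                        & reverse p.1 p.2 && (tail p.1 != head p.1)]|.

Definition is_circuit g : bool := (g != [::]) && path.cycle follows g.
Definition circuit : Type := {g : seq (edge G) | is_circuit g}.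
HB.instance Definition _ := Choice.on circuit.

Definition rot_rel : rel circuit := fun x y =>
  val y \in [seq rot i (val x) | i <- iota 0 (size (val x))].

Lemma rot_relP (x y : circuit) :
  reflect (exists i, val y = rot i (val x)) (rot_rel x y).
Proof.
apply: (iffP mapP) => [[i _ ->] | [i ->]]; first by exists i.
have [lt_i | ge_i] := ltnP i (size (val x)).
  by exists i; rewrite // mem_iota.
exists 0%N; last by rewrite rot_oversize // rot0.
by rewrite mem_iota; case: x {ge_i} => -[].
Qed.

Lemma rot_rel_equiv : equiv_class_of rot_rel.
Proof.
have sym x y : rot_rel x y -> rot_rel y x.
  move=> /rot_relP[i yx]; apply/rot_relP; exists (size (val y) - i)%N.
  by rewrite yx -/(rotr i _) rotK.
split=> [x | x y | y x z].
- by apply/rot_relP; exists 0%N; rewrite rot0.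
- by apply/idP/idP; apply: sym.
move=> /rot_relP[i yx] /rot_relP[j zy]; apply/rot_relP.
by rewrite zy yx rot_rot_add; eexists.
Qed.

Canonical rot_equiv := EquivRelPack rot_rel_equiv.

Definition cyc : Type := {eq_quot rot_equiv}%qT.
HB.instance Definition _ := Choice.on cyc.
HB.instance Definition _ := EqQuotient.on cyc.

Definition primitive (c : cyc) : Prop :=
  forall (x d : circuit) (k : nat), \pi_cyc x = c -> (1 < k)%N ->
    val x <> flatten (nseq k (val d)).

End Digraph.
Arguments nedge {K} G.
Arguments nonparallel {K} G.
Arguments reciprocal {K} G.
Arguments mxA {K} G.
Arguments mxW {K} G.
Arguments mxWstar {K} G.
Arguments mxDout {K} G.
Arguments mxDin {K} G.
Arguments mxAsym {K} G.
Arguments mxWsym {K} G.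
Arguments mxDsym {K} G.
Arguments nloop {K} G c.
Arguments nrecip {K} G.
Arguments circuit {K} G.
Arguments cyc {K} G.

Variant dir := Up | Dn.
Definition bool_of_dir d := if d is Up then true else false.
Definition dir_of_bool (b : bool) := if b then Up else Dn.
Lemma bool_of_dirK : cancel bool_of_dir dir_of_bool. Proof. by case. Qed.
HB.instance Definition _ := Finite.copy dir (can_type bool_of_dirK).

Section UpDown.
Variables (K : fieldType) (G : wdigraph K).

(* (e, Up) is the edge e of G, (e, Dn) the reverse edge added to it *)
Definition edge_ud : finType := (edge G * dir)%type.
Definition tail_ud (e : edge_ud) := if e.2 is Up then tail e.1 else head e.1.
Definition head_ud (e : edge_ud) := if e.2 is Up then head e.1 else tail e.1.
Definition wt_ud (e : edge_ud) := if e.2 is Up then wt e.1 else (wt e.1)^-1.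
Fact wt_ud_neq0 e : wt_ud e != 0.
Proof. by rewrite /wt_ud; case: e.2; rewrite ?invr_eq0 wt_neq0. Qed.

Definition updown : wdigraph K :=
  {| nvert := nvert G; edge := edge_ud; tail := tail_ud; head := head_ud;
     wt := wt_ud; wt_neq0 := wt_ud_neq0 |}.

Definition dirE (e : edge updown) : dir := e.2.

Definition ndir (d : dir) (g : seq (edge updown)) : nat :=
  count (fun e => dirE e == d) g.
(* [zip g (rot 1 g)] lists the pairs (e_i, e_{i+1}), indices mod l *)
Definition nback (d d' : dir) (g : seq (edge updown)) : nat :=
  count (fun p : edge updown * edge updown =>
           [&& dirE p.1 == d, dirE p.2 == d' & reverse p.1 p.2])
        (zip g (rot 1 g)).

(* rows and columns follow the enumeration of the edges *)
Definition mxB (d d' : dir) : 'M[K]_(nedge updown) := \matrix_(i, j)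
  (let e := enum_val i : edge updown in let e' := enum_val j : edge updown in
   if [&& dirE e == d, dirE e' == d' & reverse e e'] then wt e else 0).
Definition mxC (d : dir) : 'M[K]_(nedge updown) := \matrix_(i, j)
  (let e := enum_val i : edge updown in let e' := enum_val j : edge updown in
   if (dirE e == d) && follows e e' then wt e else 0).

End UpDown.

Section Zeta.
Variable K : fieldType.

(* K[t][u]: t_UpUp, t_DnDn, t_UpDn, t_DnUp are variables 0, 1, 2, 3 of the
   coefficient ring, u_Up and u_Dn are variables 0 and 1. *)
Definition tpoly : idomainType := {mpoly K[4]}.
Definition tupoly : idomainType := {mpoly tpoly[2]}.

Definition tvar (d d' : dir) : tpoly :=
  'X_(inord match d, d' with
            | Up, Up => 0 | Dn, Dn => 1 | Up, Dn => 2 | Dn, Up => 3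
            end%N).
Definition uvar (d : dir) : tupoly :=
  'X_(inord match d with Up => 0 | Dn => 1 end%N).
Definition tcst (c : tpoly) : tupoly := c%:MP.
Definition cst (c : K) : tupoly := tcst c%:MP.

(* p(a_0, a_1, a_2, a_3, u) *)
Definition tsubst (a : 4.-tuple tpoly) (p : tupoly) : tupoly :=
  map_mpoly (comp_mpoly a) p.

Variable G : wdigraph K.

Definition circuit_term (g : seq (edge (updown G))) : tupoly :=
  cst (\prod_(e <- g) wt e)
  * tcst (tvar Up Up ^+ nback Up Up g * tvar Dn Dn ^+ nback Dn Dn g
          * tvar Up Dn ^+ nback Up Dn g * tvar Dn Up ^+ nback Dn Up g)
  * uvar Up ^+ ndir Up g * uvar Dn ^+ ndir Dn g.

(* the term does not depend on the representative of the cycle *)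
Definition zeta_factor (c : cyc (updown G)) : fps 2 tpoly :=
  (1 - fps_of_mpoly (circuit_term (val (repr c))))^-1.

Definition zeta : fps 2 tpoly := fps_prod (@primitive _ (updown G)) zeta_factor.

Definition mxM : 'M[tupoly]_(nedge (updown G)) :=
  let C d := map_mx cst (mxC G d) in
  let B d d' := map_mx cst (mxB G d d') in
  let t d d' := tcst (tvar d d') in
  uvar Up *: (C Up + (t Up Up - 1) *: B Up Up + (t Up Dn - 1) *: B Up Dn)
  + uvar Dn *: (C Dn + (t Dn Dn - 1) *: B Dn Dn + (t Dn Up - 1) *: B Dn Up).

End Zeta.

(* Main.v *)
Require Import Defs.
From HB Require Import structures.
From mathcomp Require Import all_boot all_order all_algebra.
From mathcomp Require Import generic_quotient fraction complex.
From mathcomp Require Import boolp classical_sets reals.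
From mathcomp Require Import freeg mpoly ring.

Set Implicit Arguments.
Unset Strict Implicit.
Unset Printing Implicit Defensive.

Import GRing.Theory.

Local Open Scope ring_scope.

(* Write E for the Euler derivation of power series in u (multiplication of the
   coefficient of u^m by |m|) and L f = E f / f.  Every entry of M is
   homogeneous of degree 1 in u, so Jacobi's formula gives
   L (1 / det (1 - M)) = \sum_(k >= 1) tr M^k.  The trace tr M^k is the sum of
   the weights of the circuits of length k, each of which is a rotation of a
   unique power of the chosen representative of a unique primitive cycle; hence
   it matches, degree by degree, the logarithmic derivative of the Euler
   product.  In characteristic 0 a series with constant term 1 is determined by
   its logarithmic derivative.

   For the two specializations, 1 - M = (1 - K) - U V, where U V is the
   edge-to-edge matrix factored through the vertices and K only links an edge to
   its image under an involution (e <-> its added reverse edge in the first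
   case, e <-> its reverse in G in the second).  If (1 - K) N' = q, then
   q^n det (1 - K - U V) = det (1 - K) det (q - V N' U), and det (1 - K) is a
   product over the orbits of the involution. *)

(** * Words and their primitive roots *)

Section Words.
Local Open Scope nat_scope.
Variable T : eqType.
Implicit Types (s w a b : seq T) (k p q i : nat).

(** Unfolds to the concatenation appearing in [primitive], so that facts about words transfer to
    cycles. *)
Definition wpow w k := flatten (nseq k w).

Lemma wpowS w k : wpow w k.+1 = w ++ wpow w k. Proof. by []. Qed.

Lemma size_wpow w k : size (wpow w k) = (k * size w).
Proof. by elim: k => // k IH; rewrite wpowS size_cat IH mulSn. Qed.

Lemma wpowD w k l : wpow w (k + l) = wpow w k ++ wpow w l.
Proof. by elim: k => // k IH; rewrite addSn !wpowS IH catA. Qed.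

Lemma wpow_cat_shift a b k : wpow (a ++ b) k ++ a = a ++ wpow (b ++ a) k.
Proof. by elim: k => [|k IH]; rewrite ?cats0 // !wpowS -!catA IH. Qed.

Lemma rot_wpow w i k : (i <= size w) -> rot i (wpow w k) = wpow (rot i w) k.
Proof.
move=> le_iw; case: k => [|k]; first by [].
have := cat_take_drop i w; set a := take i w; set b := drop i w => ab.
have si : size a = i by rewrite size_takel.
rewrite /rot -/a -/b -[in LHS]ab wpowS -catA -si.
by rewrite drop_size_cat ?take_size_cat // -catA wpow_cat_shift catA.
Qed.

(** For [q > 0] commutation forces [b] to begin with [a]; once this prefix is removed, the rest
    still commutes with [a], and induction on [q] applies. *)
Lemma commute_wpow a b q : size b = (q * size a) -> a ++ b = b ++ a ->
  b = wpow a q.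
Proof.
elim: q b => [|q IH] b; first by move/size0nil->.
rewrite mulSn => sb ab; have := cat_take_drop (size a) b.
have -> : take (size a) b = a.
  have := congr1 (take (size a)) ab.
  by rewrite take_size_cat // takel_cat // sb leq_addr.
set c := drop _ _ => eq_b; rewrite -eq_b wpowS -(IH c) //.
  by rewrite size_drop sb addKn.
by move: ab; rewrite -eq_b -catA => /(congr1 (drop (size a)));
   rewrite !drop_size_cat.
Qed.

(** [rot] past the size of a word is the identity, not a rotation modulo the size; hence the bound
    on [q]. *)
Lemma rot_sub_fixed w p q : (p <= q <= size w) ->
  rot p w = w -> rot q w = w -> rot (q - p) w = w.
Proof.
move=> /andP[le_pq le_qw] wp wq; rewrite -[RHS]wq -{2}(subnK le_pq) rotD ?wp //.
by rewrite subnK.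
Qed.

Lemma rot_fixed_wpow w p : p %| size w -> (0 < p) -> rot p w = w ->
  w = wpow (take p w) (size w %/ p).
Proof.
move=> p_dv p_gt0 wp; have [/size0nil ->|w_n0] := posnP (size w).
  by rewrite div0n.
have le_pw : (p <= size w) by apply: dvdn_leq.
have : (0 < size w %/ p) by rewrite divn_gt0.
case def_q: (size w %/ p) => [//|q] _; rewrite wpowS.
rewrite -{1}(cat_take_drop p w); congr (_ ++ _); apply: commute_wpow.
  rewrite size_drop size_takel // -[size w](divnK p_dv) def_q.
  by rewrite mulSn addKn.
by rewrite cat_take_drop -[RHS]/(rot p w) wp.
Qed.

(** The witness exceeds the size so that it is positive for the empty word too. *)
Fact period_ex w : exists p, (0 < p) && (rot p w == w).
Proof. by exists (size w).+1; rewrite /= rot_oversize ?eqxx. Qed.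

Definition period w := ex_minn (period_ex w).

Lemma period_gt0 w : (0 < period w).
Proof. by rewrite /period; case: ex_minnP => p /andP[]. Qed.

Lemma rot_period w : rot (period w) w = w.
Proof. by rewrite /period; case: ex_minnP => p /andP[_ /eqP]. Qed.

Lemma period_min w p : (0 < p) -> rot p w = w -> (period w <= p).
Proof.
move=> p_gt0 wp; rewrite /period; case: ex_minnP => q _; apply.
by rewrite p_gt0 wp /=.
Qed.

(** Euclid's argument: subtracting the least period from a positive [q] leaves a smaller shift that
    still fixes [w]. *)
Lemma period_dvd w q : (q <= size w) -> rot q w = w -> period w %| q.
Proof.
elim/ltn_ind: q => q IH le_qw wq; have [->|q_gt0] := posnP q.
  exact: dvdn0.
have le_pq := period_min q_gt0 wq.
have : period w %| q - period w.
  apply: IH; first by rewrite ltn_subrL period_gt0.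
    by apply: leq_trans le_qw; rewrite leq_subr.
  by apply: rot_sub_fixed => //; [rewrite le_pq | apply: rot_period].
by rewrite dvdn_subl.
Qed.

Lemma period_rot i w : period (rot i w) = period w.
Proof.
rewrite /period; apply: eq_ex_minn => p.
by rewrite rot_rot (inj_eq (@rot_inj i _)).
Qed.

(** Primitivity through rotations: no shift strictly between 0 and the size fixes the word.
    [primitiveP] relates this to not being a proper power. *)
Definition primitive_word w := (w != [::]) && (period w == size w).

Lemma primitive_word_rot i w : primitive_word (rot i w) = primitive_word w.
Proof.
by rewrite /primitive_word period_rot size_rot -!size_eq0 size_rot.
Qed.

Definition wroot w := take (period w) w.

Lemma period_dvd_size w : period w %| size w.
Proof. by apply: period_dvd => //; rewrite rot_size. Qed.

Lemma wrootK w : wpow (wroot w) (size w %/ period w) = w.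
Proof.
by rewrite -rot_fixed_wpow ?period_dvd_size ?period_gt0 ?rot_period.
Qed.

Lemma size_wroot w : w != [::] -> size (wroot w) = period w.
Proof.
rewrite -size_eq0 -lt0n => w0.
by rewrite size_takel // dvdn_leq // period_dvd_size.
Qed.

Lemma wroot_neq0 w : w != [::] -> wroot w != [::].
Proof. by move=> w0; rewrite -size_eq0 size_wroot // -lt0n period_gt0. Qed.

Lemma rot_size_wpow w k : rot (size w) (wpow w k) = wpow w k.
Proof. by rewrite rot_wpow // rot_size. Qed.

(** Rotating by the period of the root also fixes [w], a power of the root; so this period is at
    least [period w], the size of the root. *)
Lemma primitive_word_wroot w : w != [::] -> primitive_word (wroot w).
Proof.
move=> w0; have r0 := wroot_neq0 w0; rewrite /primitive_word r0 /=.
have dv := period_dvd_size (wroot w).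
rewrite eqn_leq dvdn_leq ?lt0n ?size_eq0 //= size_wroot //.
apply: period_min; first exact: period_gt0.
have := rot_wpow (size w %/ period w) (dvdn_leq _ dv).
rewrite rot_period wrootK; apply; by rewrite lt0n size_eq0.
Qed.

Lemma wpow_neq0 w k : w != [::] -> (0 < k) -> wpow w k != [::].
Proof.
by move=> w0 k0; rewrite -size_eq0 size_wpow muln_eq0 size_eq0 (negPf w0)
  orbF -lt0n.
Qed.

Lemma take_wpow w j k : (j <= k) -> take (j * size w) (wpow w k) = wpow w j.
Proof.
by move=> le_jk; rewrite -(subnKC le_jk) wpowD take_size_cat ?size_wpow.
Qed.

(** [rot (size w)] fixes the power [v], so [period v] divides [size w]. Hence the prefix [w] of [v]
    is a power of [wroot v] and is fixed by [rot (period v)]; primitivity of [w] gives the other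
    inequality. *)
Lemma period_primitive_word_wpow w k : primitive_word w -> (0 < k) ->
  period (wpow w k) = size w.
Proof.
move=> /andP[w0 /eqP pw] k0; set v := wpow w k.
have v0 : v != [::] by apply: wpow_neq0.
have le_wv : (size w <= size v) by rewrite size_wpow leq_pmull.
have dv : period v %| size w by rewrite period_dvd // rot_size_wpow.
have w_gt0 : (0 < size w) by rewrite lt0n size_eq0.
apply/eqP; rewrite eqn_leq dvdn_leq //= -{1}pw period_min ?period_gt0 //.
have tw : w = wpow (wroot v) (size w %/ period v).
  rewrite -(@take_wpow _ _ (size v %/ period v)) ?leq_div2r // wrootK.
  rewrite size_wroot // divnK // -[size w]mul1n take_wpow //.
  by rewrite /wpow /= cats0.
by rewrite -size_wroot // [in LHS]tw rot_size_wpow -tw.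
Qed.

Lemma wroot_primitive_word_wpow w k :
  primitive_word w -> (0 < k) -> wroot (wpow w k) = w.
Proof.
move=> pw k0; rewrite /wroot period_primitive_word_wpow //.
rewrite -[size w]mul1n take_wpow //.
by rewrite /wpow /= cats0.
Qed.

Lemma primitive_word_exponent w d k :
  primitive_word w -> w = wpow d k -> k = 1%N.
Proof.
move=> /andP[w0 /eqP pw] wd.
have d0 : (0 < size d).
  rewrite lt0n; apply: contraNneq w0 => d0.
  by rewrite -size_eq0 wd size_wpow d0 muln0.
have k0 : (0 < k) by rewrite lt0n; apply: contraNneq w0; rewrite wd => ->.
have: (size w <= size d).
  by rewrite -pw period_min // {1}wd rot_size_wpow.
rewrite wd size_wpow -{2}[size d]mul1n leq_pmul2r // => k1.
by apply/eqP; rewrite eqn_leq k1.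
Qed.

Lemma primitive_word_rot_inj w i j :
  primitive_word w -> (i < size w) -> (j < size w) ->
  rot i w = rot j w -> i = j.
Proof.
move=> /andP[_ /eqP pw]; wlog le_ij : i j / (i <= j) => [hw|] iw jw eq_ij.
  by case: (leqP i j) => [|/ltnW] le; [|symmetry]; apply: hw.
have wij : rot (j - i) w = w.
  apply: (@rot_inj i _); rewrite -rotD ?subnKC // 1?ltnW //.
have : period w %| j - i.
  by apply: period_dvd => //; apply: leq_trans (leq_subr _ _) (ltnW jw).
rewrite pw => dv; apply/eqP; rewrite eqn_leq le_ij /=.
rewrite -subn_eq0; apply: contraLR dv; rewrite -lt0n => ij0.
by rewrite gtnNdvd // (leq_ltn_trans (leq_subr _ _)).
Qed.

(** The cyclically consecutive pairs, listed as in [nback]. The circuit condition, the weight and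
    the turn-back counts are all read off this list. *)
Definition links w := zip w (rot 1 w).

Lemma size_links w : size (links w) = size w.
Proof. by rewrite size_zip size_rot minnn. Qed.

Lemma links_wpow w k : links (wpow w k) = flatten (nseq k (links w)).
Proof.
case: w => [|x w]; first by rewrite /links; elim: k.
rewrite /links rot_wpow //; elim: k => // k IH.
by rewrite !wpowS zip_cat ?size_rot // IH.
Qed.

Lemma rot_zip (U V : Type) i (s : seq U) (t : seq V) :
  size s = size t -> rot i (zip s t) = zip (rot i s) (rot i t).
Proof.
move=> st; rewrite /rot zip_cat ?size_drop ?st //; congr (_ ++ _).
  by elim: i s t st => [|i IH] [|x s] [|y t] //= [/IH].
by elim: i s t st => [|i IH] [|x s] [|y t] //= [/IH->].
Qed.

Lemma links_rot i w : links (rot i w) = rot i (links w).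
Proof. by rewrite /links rot_rot rot_zip // size_rot. Qed.

Lemma cycle_links (e : rel T) w :
  path.cycle e w = all (fun z => e z.1 z.2) (links w).
Proof.
case: w => // x w; rewrite /links rot1_cons /=.
elim: w {1 3}x => [|y w IH] z //=.
by rewrite IH.
Qed.

Lemma cycle_wpow (e : rel T) w k : (0 < k) ->
  path.cycle e (wpow w k) = path.cycle e w.
Proof.
rewrite !cycle_links links_wpow; case: k => // k _.
elim: k => [|k IH]; first by rewrite /= cats0.
by rewrite -[in RHS]IH [in LHS]/= all_cat {1}IH andbb.
Qed.

Lemma cycle_wroot (e : rel T) w : w != [::] ->
  path.cycle e (wroot w) = path.cycle e w.
Proof.
move=> w0; rewrite -[in RHS](wrootK w) cycle_wpow // divn_gt0 ?period_gt0 //.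
by rewrite dvdn_leq ?period_dvd_size // lt0n size_eq0.
Qed.

End Words.

Section ListWords.
Local Open Scope nat_scope.
Variable T : finType.

Fixpoint words k : seq (seq T) :=
  if k is k'.+1 then [seq x :: w | x <- enum T, w <- words k'] else [:: [::]].

Lemma mem_words k w : (w \in words k) = (size w == k).
Proof.
elim: k w => [|k IH] w; first by rewrite inE -size_eq0.
apply/allpairsP/eqP => [[[x v] /= [_ vk ->]]|].
  by move: vk; rewrite IH /= => /eqP ->.
case: w => // x w [sw]; exists (x, w).
  by split; rewrite ?mem_enum ?IH ?sw.
Qed.

Lemma words_uniq k : uniq (words k).
Proof.
elim: k => // k IH; apply: allpairs_uniq => //; first exact: enum_uniq.
by move=> [x v] [y w] _ _ /= [-> ->].
Qed.

End ListWords.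

(** * Logarithmic derivatives of power series *)

Section Derivations.
Variables (R : comNzRingType) (D : {additive R -> R}).
Hypothesis DM : forall x y, D (x * y) = D x * y + x * D y.

Lemma derivation_prod (I : eqType) (r : seq I) (F : I -> R) : uniq r ->
  D (\prod_(i <- r) F i) =
  \sum_(i <- r) D (F i) * \prod_(j <- r | j != i) F j.
Proof.
have D1 : D 1 = 0.
  by apply: (addrI (D 1)); rewrite addr0 -{3}[1]mulr1 DM mulr1 mul1r.
elim: r => [|x r IH] /=; first by rewrite !big_nil.
move=> /andP[xr ur]; rewrite !big_cons DM IH // eqxx /= mulr_sumr.
congr (_ * _ + _).
  rewrite [LHS]big_seq [RHS]big_seq_cond; apply: eq_bigl => i.
  by case: eqP => [->|_]; rewrite ?andbT // andbF (negPf xr).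
rewrite !big_seq; apply: eq_bigr => i ir; rewrite mulrCA big_cons.
by case: eqP ir xr => [->->//|_ _ _].
Qed.

(** Jacobi's formula. The Leibniz rule gives one determinant [B i] per row, with [D] applied to row
    i only; expanding along that row leaves the cofactors of [A]. *)
Lemma derivation_det p (A : 'M[R]_p) :
  D (\det A) = \sum_i \sum_j D (A i j) * cofactor A i j.
Proof.
pose B i := \matrix_(k, l) if k == i then D (A i l) else A k l.
transitivity (\sum_i \det (B i)).
  rewrite /determinant raddf_sum exchange_big /=; apply: eq_bigr => s _.
  rewrite raddfMsign derivation_prod ?index_enum_uniq // mulr_sumr.
  apply: eq_bigr => i _; congr (_ * _).
  rewrite [RHS](bigD1 i) //= mxE eqxx; congr (_ * _).
  by apply: eq_bigr => j ji; rewrite mxE (negPf ji).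
apply: eq_bigr => i _; rewrite (expand_det_row _ i); apply: eq_bigr => j _.
rewrite mxE eqxx /cofactor; congr (_ * (_ * \det _)).
by apply/matrixP => k l; rewrite !mxE eq_sym (negPf (neq_lift _ _)).
Qed.

End Derivations.

Section FpsTheory.
Variables (n : nat) (R : comNzRingType).
Implicit Types (f g h x : fps n R) (m : 'X_{1..n}) (d : nat).

Lemma fps_addE f g m : (f + g) m = f m + g m. Proof. by []. Qed.
Lemma fps_oppE f m : (- f) m = - f m. Proof. by []. Qed.

Lemma fps_coeff_sum I (r : seq I) (P : pred I) (F : I -> fps n R) m :
  (\sum_(i <- r | P i) F i) m = \sum_(i <- r | P i) F i m.
Proof. exact: (big_morph (fun f : fps n R => f m)). Qed.

Lemma fps_coeff_mulrn f k m : (f *+ k) m = f m *+ k.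
Proof. by elim: k => // k IH; rewrite !mulrS fps_addE IH. Qed.

Fact fps_of_mpoly_is_zmod_morphism : zmod_morphism (@fps_of_mpoly n R).
Proof. by move=> p q; apply/funext => m; rewrite /fps_of_mpoly mcoeffB. Qed.

Fact fps_of_mpoly_is_monoid_morphism : monoid_morphism (@fps_of_mpoly n R).
Proof.
by split=> // p q; apply/funext => m; symmetry; apply: fps_mul_mcoeff.
Qed.

HB.instance Definition _ := GRing.isZmodMorphism.Build
  {mpoly R[n]} (fps n R) (@fps_of_mpoly n R) fps_of_mpoly_is_zmod_morphism.
HB.instance Definition _ := GRing.isMonoidMorphism.Build
  {mpoly R[n]} (fps n R) (@fps_of_mpoly n R) fps_of_mpoly_is_monoid_morphism.

Lemma fps_coeff1 m : (1 : fps n R) m = (m == 0%MM)%:R.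
Proof. by rewrite -[LHS]/((1 : {mpoly R[n]})@_m) mcoeff1. Qed.

(** [fps_ord d (f - g)] serves as congruence modulo terms of total degree at least [d]. *)
Definition fps_ord d f := forall m, (mdeg m < d)%N -> f m = 0.

Lemma fps_ordD d f g : fps_ord d f -> fps_ord d g -> fps_ord d (f + g).
Proof. by move=> fd gd m lt_m; rewrite fps_addE fd // gd // addr0. Qed.

Lemma fps_ordN d f : fps_ord d f -> fps_ord d (- f).
Proof. by move=> fd m lt_m; rewrite fps_oppE fd // oppr0. Qed.

Lemma fps_ord_sum d I (r : seq I) (P : pred I) (F : I -> fps n R) :
  (forall i, P i -> fps_ord d (F i)) -> fps_ord d (\sum_(i <- r | P i) F i).
Proof. by move=> Fd; elim/big_rec: _ => // i f Pi; apply/fps_ordD/Fd. Qed.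

Lemma fps_ordW d d' f : (d <= d')%N -> fps_ord d' f -> fps_ord d f.
Proof. by move=> le_d fd m lt_m; apply/fd/(leq_trans lt_m). Qed.

Lemma fps_ordM d d' f g :
  fps_ord d f -> fps_ord d' g -> fps_ord (d + d') (f * g).
Proof.
move=> fd gd m lt_m; rewrite -[LHS]/(fps_mul f g m) /fps_mul.
apply: big1 => -[[k1 /= _] [k2 /= _]] /eqP def_m.
have [lt_k|le_k] := ltnP (mdeg k1) d.
  by rewrite fd ?mul0r.
rewrite [g _]gd ?mulr0 // -(ltn_add2l d) (leq_ltn_trans _ lt_m) //.
by rewrite def_m mdegD leq_add2r.
Qed.

Lemma fps_ordMr d f g : fps_ord d f -> fps_ord d (f * g).
Proof. by move=> fd; rewrite -[d]addn0; apply: fps_ordM. Qed.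

Lemma fps_ordX d f k : fps_ord d f -> fps_ord (d * k) (f ^+ k).
Proof.
move=> fd; elim: k => [|k IH]; first by rewrite muln0.
by rewrite exprS mulnS; apply: fps_ordM.
Qed.

Lemma mdeg_lt1 m : (mdeg m < 1)%N = (m == 0%MM).
Proof. by rewrite ltnS leqn0 mdeg_eq0. Qed.

(* The inverse is the geometric series in [1 - f]. *)
Lemma fps_unit_coeff0 f : f 0%MM = 1 -> f \is a GRing.unit.
Proof.
move=> f0; pose h := 1 - f.
have h1 : fps_ord 1 h.
  move=> m; rewrite mdeg_lt1 => /eqP->.
  by rewrite /h fps_addE fps_oppE f0 fps_coeff1 eqxx subrr.
have hX k : fps_ord k (h ^+ k) by have := fps_ordX (k := k) h1; rewrite mul1n.
(* Since [h ^+ k] has order [k], only the powers up to [mdeg m] reach the coefficient at [m], so the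
   infinite sum is defined coefficientwise. *)
pose g : fps n R := fun m => (\sum_(k < (mdeg m).+1) h ^+ k) m.
apply/unitrPr; exists g; apply/funext => m.
pose gd := \sum_(k < (mdeg m).+1) h ^+ k.
have g_gd : fps_ord (mdeg m).+1 (g - gd).
  move=> m' lt_m'; rewrite fps_addE fps_oppE; apply/eqP; rewrite subr_eq0.
  apply/eqP; rewrite /g /gd !fps_coeff_sum.
  rewrite (big_ord_widen _ (fun k => (h ^+ k) m') lt_m') big_mkcond /=.
  by apply: eq_bigr => k _; case: ltnP => // /hX ->.
have -> : f * g = f * gd + f * (g - gd) by rewrite -mulrDr addrCA subrr addr0.
rewrite fps_addE [f * (g - gd)]mulrC (fps_ordMr _ g_gd) // addr0.
have -> : f * gd = 1 - h ^+ (mdeg m).+1.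
  have fh : f = - (h - 1) by rewrite opprB /h opprB addrCA subrr addr0.
  by rewrite {1}fh mulNr -subrX1 opprB.
by rewrite fps_addE fps_oppE hX // subr0.
Qed.

Definition fps_euler f : fps n R := fun m => f m *+ mdeg m.

Fact fps_euler_is_zmod_morphism : zmod_morphism fps_euler.
Proof.
by move=> f g; apply/funext => m; rewrite /fps_euler fps_addE mulrnDl mulNrn.
Qed.

HB.instance Definition _ := GRing.isZmodMorphism.Build
  (fps n R) (fps n R) fps_euler fps_euler_is_zmod_morphism.

Lemma fps_eulerM f g :
  fps_euler (f * g) = fps_euler f * g + f * fps_euler g.
Proof.
apply/funext => m; rewrite fps_addE.
change (fps_mul f g m *+ mdeg m =
        fps_mul (fps_euler f) g m + fps_mul f (fps_euler g) m).
rewrite /fps_mul /fps_euler -sumrMnl -big_split /=; apply: eq_bigr.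
by move=> [[k1 /= _] [k2 /= _]] /eqP->; rewrite mdegD mulrnDr mulrnAl mulrnAr.
Qed.

Lemma fps_euler1 : fps_euler 1 = 0.
Proof.
apply/funext => m; rewrite /fps_euler fps_coeff1.
by case: eqP => [->|_]; rewrite ?mdeg0 ?mul0rn.
Qed.

Lemma fps_euler_linear (c : R) (i : 'I_n) :
  fps_euler (fps_of_mpoly (c%:MP * 'X_i)) = fps_of_mpoly (c%:MP * 'X_i).
Proof.
apply/funext => m; rewrite /fps_euler /fps_of_mpoly mcoeffCM mcoeffX.
by case: eqP => [<-|_]; rewrite ?mdeg1 // mulr0 mul0rn.
Qed.

Lemma fps_euler_prod I (r : seq I) (F : I -> fps n R) :
  (forall i, fps_euler (F i) = F i) ->
  fps_euler (\prod_(i <- r) F i) = (\prod_(i <- r) F i) *+ size r.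
Proof.
move=> EF; elim: r => [|i r IH]; first by rewrite big_nil fps_euler1.
by rewrite !big_cons fps_eulerM IH EF mulrS mulrnAr.
Qed.

Definition fps_logder f := fps_euler f / f.

Lemma fps_logderM f g : f \is a GRing.unit -> g \is a GRing.unit ->
  fps_logder (f * g) = fps_logder f + fps_logder g.
Proof.
move=> uf ug; rewrite /fps_logder fps_eulerM invrM // mulrDl.
congr (_ + _); first by rewrite -mulrA mulVKr.
by rewrite [f * _]mulrC [g^-1 * _]mulrC -mulrA mulVKr.
Qed.

Definition fps_coeff0 f := f 0%MM.

Fact fps_coeff0_is_zmod_morphism : zmod_morphism fps_coeff0.
Proof. by []. Qed.

Fact fps_coeff0_is_monoid_morphism : monoid_morphism fps_coeff0.
Proof.
split=> [|f g]; first by rewrite /fps_coeff0 fps_coeff1 eqxx.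
have cst0 h k : (mdeg k <= mdeg (0%MM : 'X_{1..n}))%N ->
    h k = ((h 0%MM)%:MP_[n])@_k.
  by rewrite mdeg0 leqn0 mdeg_eq0 => /eqP->; rewrite mcoeffC eqxx mulr1.
rewrite /fps_coeff0 -[LHS]/(fps_mul f g _).
by rewrite (fps_mul_mcoeff (cst0 f) (cst0 g)) -mpolyCM mcoeffC eqxx mulr1.
Qed.

HB.instance Definition _ := GRing.isZmodMorphism.Build
  (fps n R) R fps_coeff0 fps_coeff0_is_zmod_morphism.
HB.instance Definition _ := GRing.isMonoidMorphism.Build
  (fps n R) R fps_coeff0 fps_coeff0_is_monoid_morphism.

Lemma fps_coeff0M f g : (f * g) 0%MM = f 0%MM * g 0%MM.
Proof. exact: (rmorphM fps_coeff0). Qed.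

Lemma fps_logder_prod I (r : seq I) (F : I -> fps n R) :
  (forall i, F i \is a GRing.unit) ->
  fps_logder (\prod_(i <- r) F i) = \sum_(i <- r) fps_logder (F i).
Proof.
move=> uF; elim: r => [|i r IH].
  by rewrite !big_nil /fps_logder fps_euler1 mul0r.
by rewrite !big_cons fps_logderM ?IH // unitr_prod.
Qed.

Lemma fps_logderV f : f \is a GRing.unit -> fps_logder f^-1 = - fps_logder f.
Proof.
move=> uf; apply: (addrI (fps_logder f)).
by rewrite -fps_logderM ?unitrV // mulrV // subrr /fps_logder fps_euler1 mul0r.
Qed.

Hypothesis char0 : forall k (c : R), c *+ k.+1 = 0 -> c = 0.

(** The quotient [h = f / g] satisfies E h = (L f - L g) h, of order [d]. In characteristic 0 the
    coefficients of [h] in positive degree below [d] then vanish, and f - g = (h - 1) g. *)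
Lemma fps_logder_eqmod d f g : f \is a GRing.unit -> g \is a GRing.unit ->
  f 0%MM = 1 -> g 0%MM = 1 ->
  fps_ord d (fps_logder f - fps_logder g) -> fps_ord d (f - g).
Proof.
move=> uf ug f0 g0 ordL; pose h := f / g.
have fE : f = h * g by rewrite /h divrK.
have uh : h \is a GRing.unit by rewrite unitrM uf unitrV.
have h0 : h 0%MM = 1.
  by have := fps_coeff0M h g; rewrite -fE f0 g0 mulr1.
have Eh : fps_ord d (fps_euler h).
  have -> : fps_euler h = (fps_logder f - fps_logder g) * h.
    by rewrite fE fps_logderM // addrK /fps_logder divrK.
  exact: fps_ordMr.
have -> : f - g = (h - 1) * g by rewrite mulrBl mul1r -fE.
apply: fps_ordMr => m lt_m; rewrite fps_addE fps_oppE fps_coeff1.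
have [->|m0] := eqVneq m 0%MM; first by rewrite h0 subrr.
rewrite subr0; have := Eh m lt_m; rewrite /fps_euler.
by case: (mdeg m) (mdeg_eq0 m) => [|k]; [rewrite (negPf m0) | move=> _ /char0].
Qed.

(** The hypothesis says that [f] is homogeneous of degree [l]: a coefficient in degree d is killed
    by d - l. *)
Lemma fps_ord_euler l f : fps_euler f = f *+ l -> fps_ord l f.
Proof.
move=> Ef m lt_m; have := congr1 (fun f => f m) Ef.
rewrite fps_coeff_mulrn /fps_euler -(subnKC lt_m) addSnnS mulrnDr.
by rewrite -[LHS]addr0 => /addrI/esym; apply: char0.
Qed.

(** The indices with [l] dividing [k.+1] enumerate the exponents 1, ..., [N %/ l] of the geometric
    series. The remainder starts with exponent [(N %/ l).+1], hence in degree above [N]. *)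
Lemma fps_ord_geom l f N : (0 < l)%N -> fps_ord l f ->
  fps_ord N.+1 (f / (1 - f) -
                \sum_(k < N | (l %| k.+1)%N) f ^+ (k.+1 %/ l)).
Proof.
move=> l0 fl; have u1f : 1 - f \is a GRing.unit.
  apply: fps_unit_coeff0; rewrite fps_addE fps_oppE fps_coeff1 eqxx.
  by rewrite fl ?subr0 // mdeg0.
have -> : \sum_(k < N | (l %| k.+1)%N) f ^+ (k.+1 %/ l) =
          \sum_(j < N %/ l) f ^+ j.+1.
  elim: N => [|N IH]; first by rewrite div0n !big_ord0.
  rewrite big_mkcond big_ord_recr -big_mkcond /= IH divnS //.
  case: ifP => [->|_]; last by rewrite add0n addr0.
  by rewrite add1n big_ord_recr.
have -> : \sum_(j < N %/ l) f ^+ j.+1 = (f - f ^+ (N %/ l).+1) / (1 - f).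
  apply: (mulIr u1f); rewrite divrK //.
  elim: (N %/ l)%N => [|q IH]; first by rewrite big_ord0 mul0r subrr.
  rewrite big_ord_recr mulrDl IH /= mulrBr mulr1 -exprSr.
  by rewrite addrA subrK.
rewrite -mulrBl opprB addrCA subrr addr0; apply: fps_ordMr.
by apply: fps_ordW (fps_ordX fl); rewrite mulnC ltn_ceil.
Qed.

Lemma fps_logder_geom l f : fps_euler f = f *+ l ->
  1 - f \is a GRing.unit -> fps_logder (1 - f)^-1 = (f / (1 - f)) *+ l.
Proof.
move=> Ef u1f; rewrite fps_logderV // /fps_logder raddfB /= fps_euler1 sub0r.
by rewrite mulNr opprK Ef mulrnAl.
Qed.

(** * Logarithmic derivative of the determinant and comparison with an Euler product *)

Section Determinant.
Variables (p : nat) (M : 'M[fps n R]_p).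
Hypothesis euler_M : forall i j, fps_euler (M i j) = M i j.
Let D := \det (1%:M - M).

Lemma fps_det_coeff0 : D 0%MM = 1.
Proof.
rewrite -[LHS]/(fps_coeff0 D) /D -det_map_mx map_mxB map_scalar_mx rmorph1.
have -> : map_mx fps_coeff0 M = 0.
  apply/matrixP => i j; rewrite !mxE /fps_coeff0.
  by apply: (@fps_ord_euler 1) => //; rewrite ?euler_M ?mdeg0.
by rewrite subr0 det1.
Qed.

Lemma fps_det_unit : D \is a GRing.unit.
Proof. exact/fps_unit_coeff0/fps_det_coeff0. Qed.

Lemma fps_euler_det : fps_euler D = - \tr (M *m \adj (1%:M - M)).
Proof.
rewrite /D (derivation_det (D := fps_euler)); last exact: fps_eulerM.
rewrite /mxtrace -sumrN; apply: eq_bigr => i _; rewrite mxE -sumrN.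
apply: eq_bigr => j _; rewrite !mxE raddfB /= euler_M.
by rewrite raddfMn /= fps_euler1 mul0rn sub0r mulNr.
Qed.

(* Multiply [\adj (1 - M) *m (1 - M) = D] by the geometric sum of [M]. *)
Lemma fps_logder_det N :
  fps_ord N.+1 (fps_logder D + \sum_(k < N) \tr (M ^+ k.+1)).
Proof.
have uD := fps_det_unit.
have ordM i j : fps_ord 1 (M i j) by apply: fps_ord_euler; rewrite euler_M.
have ordMX k i j : fps_ord k ((M ^+ k) i j).
  elim: k i j => [|k IH] i j //; rewrite exprS mxE; apply: fps_ord_sum => l _.
  by rewrite -[k.+1]add1n; apply: fps_ordM.
pose S := \sum_(k < N) M ^+ k.
have DS : D *: (M *m S) = M *m \adj (1%:M - M) *m (1%:M - M ^+ N).
  have -> : 1%:M - M ^+ N = (1%:M - M) *m S.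
    rewrite -[1%:M - M]opprB mulNmx -[_ *m S]/((M - 1) * S) -subrX1.
    by rewrite opprB.
  rewrite mulmxA -[_ *m (1%:M - M)]mulmxA mul_adj_mx mul_mx_scalar.
  by rewrite -scalemxAl.
have trS : \sum_(k < N) \tr (M ^+ k.+1) = \tr (M *m S).
  rewrite mulmx_sumr raddf_sum; apply: eq_bigr => k _; by rewrite exprS.
(* What remains after [N] traces contains [N.+1] factors [M], each of order 1. *)
have -> : fps_logder D + \sum_(k < N) \tr (M ^+ k.+1) =
    - \tr (M *m \adj (1%:M - M) *m M ^+ N) / D.
  apply: (mulIr uD); rewrite mulrDl !divrK // fps_euler_det trS mulrC.
  rewrite -mxtraceZ DS mulmxBr mulmx1 raddfB /= addrA addNr add0r.
  by [].
apply/fps_ordMr/fps_ordN; apply: fps_ord_sum => i _; rewrite mxE.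
apply: fps_ord_sum => j _; rewrite mxE -[N.+1]add1n; apply: fps_ordM => //.
by apply: fps_ord_sum => k _; apply: fps_ordMr.
Qed.

(** By [fps_logder_eqmod] it is enough to compare logarithmic derivatives. A factor contributes
    [l i] times a geometric series in [x i], and the hypothesis on traces regroups these terms by
    degree. *)
Lemma fps_euler_product I (r : seq I) (l : I -> nat) (x : I -> fps n R) N :
    (forall i, 0 < l i)%N -> (forall i, fps_euler (x i) = x i *+ l i) ->
    (forall k, (k < N)%N -> \tr (M ^+ k.+1) =
      \sum_(i <- r | (l i %| k.+1)%N) x i ^+ (k.+1 %/ l i) *+ l i) ->
  fps_ord N.+1 (\prod_(i <- r) (1 - x i)^-1 - D^-1).
Proof.
move=> l0 Ex trM; have uD := fps_det_unit.
have x0 i : x i 0%MM = 0 by apply: fps_ord_euler (Ex i) _ _; rewrite mdeg0.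
have coV f : f \is a GRing.unit -> f 0%MM = 1 -> f^-1 0%MM = 1.
  move=> uf f0.
  by have := fps_coeff0M f f^-1; rewrite mulrV // fps_coeff1 eqxx f0 mul1r.
have c1x i : (1 - x i) 0%MM = 1.
  by rewrite fps_addE fps_oppE fps_coeff1 eqxx x0 subr0.
have u1x i : 1 - x i \is a GRing.unit by apply: fps_unit_coeff0.
apply: fps_logder_eqmod.
- by rewrite unitr_prod // => i _; rewrite unitrV.
- by rewrite unitrV.
- rewrite -[LHS]/(fps_coeff0 _) rmorph_prod big1 // => i _.
  by rewrite /= /fps_coeff0 coV.
- by rewrite coV // fps_det_coeff0.
rewrite fps_logderV // opprK fps_logder_prod; last by move=> i; rewrite unitrV.
have trE : \sum_(k < N) \tr (M ^+ k.+1) = \sum_(i <- r)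
    (\sum_(k < N | (l i %| k.+1)%N) x i ^+ (k.+1 %/ l i)) *+ l i.
  rewrite (eq_bigr _ (fun k _ => trM _ (ltn_ord k))).
  rewrite (exchange_big_dep xpredT) //=.
  by apply: eq_bigr => i _; rewrite sumrMnl.
have := fps_logder_det (N := N); rewrite {}trE.
set B := \sum_(i <- r) _ => ordD.
set A := \sum_(i <- r) _.
(* [B] is the sum of traces regrouped by index: [A - B] collects geometric tails, and
   [fps_logder D + B] is the tail of the trace expansion. *)
have -> : A + fps_logder D = (A - B) + (fps_logder D + B).
  by rewrite addrACA addNr addr0.
apply: fps_ordD; last exact: ordD.
rewrite -sumrB; apply: fps_ord_sum => i _.
rewrite (fps_logder_geom (Ex i)) // -mulrnBl -mulr_natr; apply: fps_ordMr.
by apply: fps_ord_geom => //; apply: fps_ord_euler.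
Qed.

End Determinant.

End FpsTheory.

(** * Traces of powers and cycles *)

Section TraceWords.
Variables (T : finType) (A : comNzRingType) (F : T -> T -> A).

Definition wweight (w : seq T) := \prod_(z <- links w) F z.1 z.2.

Lemma wweight_wpow w k : wweight (wpow w k) = wweight w ^+ k.
Proof.
rewrite /wweight links_wpow; elim: k => [|k IH]; first by rewrite big_nil.
by rewrite [flatten _]/= big_cat IH exprS.
Qed.

Lemma wweight_rot i w : wweight (rot i w) = wweight w.
Proof.
by rewrite /wweight links_rot; apply: perm_big; rewrite perm_rot.
Qed.

(** The exponent is positive because exponent 0 would give the trace [#|T|], against a single empty
    word. *)
Lemma trace_words k :
  \tr ((\matrix_(i, j < #|T|) F (enum_val i) (enum_val j)) ^+ k.+1) =
  \sum_(w <- words T k.+1) wweight w.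
Proof.
set X := \matrix_(i, j) _.
have sum_enum (H : T -> A) :
    \sum_(i < #|T|) H (enum_val i) = \sum_(x <- enum T) H x.
  by rewrite big_enum -[LHS]big_enum_val.
(* An entry of the power is a sum over walks from i to j with [k] intermediate points; closing them
   up gives the trace. *)
have XE i j : (X ^+ k.+1) i j = \sum_(w <- words T k)
    \prod_(z <- zip (enum_val i :: w) (rcons w (enum_val j))) F z.1 z.2.
  elim: k i => [|k IH] i; first by rewrite big_seq1 big_seq1 mxE.
  rewrite exprS mxE big_allpairs_dep -sum_enum; apply: eq_bigr => l _.
  rewrite IH mxE mulr_sumr; apply: eq_bigr => w _.
  by rewrite /= big_cons.
rewrite /mxtrace (eq_bigr _ (fun i _ => XE i i)) big_allpairs_dep.
rewrite (sum_enum (fun x => \sum_(w <- words T k)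
  \prod_(z <- zip (x :: w) (rcons w x)) F z.1 z.2)).
apply: eq_bigr => x _; apply: eq_bigr => w _.
by rewrite /wweight /links rot1_cons.
Qed.

End TraceWords.

Section Cycles.
Local Open Scope quotient_scope.
Variables (K : fieldType) (G : wdigraph K).
Implicit Types (c : cyc G) (x y : circuit G) (w : seq (edge G)).

(** The representative that [zeta_factor] uses. *)
Definition cycword c : seq (edge G) := val (repr c).

Lemma cycword_circuit c : is_circuit (cycword c).
Proof. exact: valP. Qed.

Lemma cycword_neq0 c : cycword c != [::].
Proof. by case/andP: (cycword_circuit c). Qed.

Lemma cycword_gt0 c : (0 < size (cycword c))%N.
Proof. by rewrite lt0n size_eq0 cycword_neq0. Qed.

Lemma eq_cycP x y :
  reflect (exists i, val y = rot i (val x)) (\pi_(cyc G) x == \pi_(cyc G) y).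
Proof. by rewrite eqmodE; apply: rot_relP. Qed.

Lemma cycword_pi x : exists2 i, (i < size (cycword (\pi_(cyc G) x)))%N
  & val x = rot i (cycword (\pi_(cyc G) x)).
Proof.
have : rot_rel (repr (\pi_(cyc G) x)) x by rewrite -eqmodE reprK.
by case/mapP => i; rewrite mem_iota => /andP[_ lt_i]; exists i.
Qed.

(** All representatives are rotations of one word, so testing one suffices. If that word is not
    primitive, its root is again a circuit and exhibits it as a proper power. *)
Lemma primitiveP c : primitive c <-> primitive_word (cycword c).
Proof.
have circ := cycword_circuit c; have w0 := cycword_neq0 c.
split=> [prim | pw x d k xc k1 def_x].
  apply: contrapT => /negP npw; set w := cycword c in circ w0 npw.
  have circ_r : is_circuit (wroot w).
    by rewrite /is_circuit wroot_neq0 // cycle_wroot //; case/andP: circ.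
  apply: (prim (repr c) (Sub (wroot w) circ_r) (size w %/ period w)%N).
  - exact: reprK.
  - move: npw (divnK (period_dvd_size w)); rewrite /primitive_word w0 /=.
    case: (size w %/ period w)%N => [|[|q]] //.
      by move=> _ /esym/eqP; rewrite mul0n size_eq0 (negPf w0).
    by rewrite mul1n => /eqP.
  - by rewrite SubK -[RHS]/(wpow (wroot w) _) wrootK.
have [i _ xi] := cycword_pi x; rewrite xc in xi.
have := pw; rewrite -(primitive_word_rot i) -xi.
move=> /primitive_word_exponent/(_ def_x) k_1.
by rewrite k_1 in k1.
Qed.

(** A closed walk of length [k] is a power of its root, and the root is a rotation of the
    representative of exactly one primitive cycle, by exactly one offset below its length. Cycles in
    [S] whose length does not divide [k] are filtered out. *)
Lemma perm_circuits k N (S : seq (cyc G)) : (0 < k <= N)%N -> uniq S ->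
    (forall c, c \in S -> primitive c) ->
    (forall c, primitive c -> (size (cycword c) <= N)%N -> c \in S) ->
  perm_eq [seq w <- words (edge G) k | path.cycle (@follows _ G) w]
    [seq rot i (wpow (cycword c) (k %/ size (cycword c)))
       | c <- [seq c <- S | (size (cycword c) %| k)%N],
         i <- iota 0 (size (cycword c))].
Proof.
move=> /andP[k0 le_kN] uS primS allS.
have pw c : c \in S -> primitive_word (cycword c) by move/primS/primitiveP.
have div_gt0 c : (size (cycword c) %| k)%N -> (0 < k %/ size (cycword c))%N.
  by move=> dv; rewrite divn_gt0 ?cycword_gt0 // dvdn_leq.
apply: uniq_perm.
- exact/filter_uniq/words_uniq.
- apply: allpairs_uniq_dep; first exact: filter_uniq.
    by move=> c _; apply: iota_uniq.
  move=> /= _ _ /allpairsPdep[c [i [cS iI ->]]]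
    /allpairsPdep[c' [i' [cS' iI' ->]]] /=.
  move: cS cS' iI iI'; rewrite !mem_filter !mem_iota !add0n /=.
  move=> /andP[dv cS] /andP[dv' cS'] lt_i lt_i'.
  rewrite !rot_wpow ?(ltnW lt_i) ?(ltnW lt_i') // => /(congr1 (@wroot _)).
  rewrite !wroot_primitive_word_wpow ?primitive_word_rot ?div_gt0 ?pw //.
  move=> eq_rot.
  have eq_c : c = c'.
    rewrite -[c]reprK -[c']reprK; apply/eqP/eq_cycP.
    have := congr1 (rotr i') eq_rot; rewrite rotK /rotr rot_rot_add => /esym.
    by eexists; eassumption.
  rewrite -{}eq_c in lt_i' eq_rot *.
  by rewrite (primitive_word_rot_inj _ _ _ eq_rot) ?pw.
move=> w; rewrite mem_filter mem_words; apply/andP/allpairsPdep.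
  move=> [cyc_w /eqP sw]; have w0 : w != [::] by rewrite -size_eq0 sw -lt0n.
  have circ_r : is_circuit (wroot w).
    by rewrite /is_circuit wroot_neq0 // cycle_wroot.
  pose x : circuit G := Sub (wroot w) circ_r; pose c := \pi_(cyc G) x.
  have [i lt_i xi] := cycword_pi x; rewrite SubK -/c in lt_i xi.
  have s_c : size (cycword c) = period w.
    by rewrite -size_wroot // xi size_rot.
  have dvw : (size (cycword c) %| k)%N by rewrite s_c -sw period_dvd_size.
  exists c, i; split; last first.
  - by rewrite rot_wpow ?(ltnW lt_i) // -xi s_c -sw wrootK.
  - by rewrite mem_iota.
  rewrite mem_filter dvw /=; apply: allS.
    apply/primitiveP; rewrite -(primitive_word_rot i) -xi.
    exact: primitive_word_wroot.
  by rewrite s_c (leq_trans _ le_kN) // -sw dvdn_leq ?sw // -sw period_dvd_size.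
move=> [c [i [cS iI ->]]]; move: cS; rewrite mem_filter => /andP[dv cS].
rewrite rot_cycle cycle_wpow ?div_gt0 //; split.
  by case/andP: (cycword_circuit c).
by rewrite size_rot size_wpow divnK.
Qed.

(** Words that are not circuits contain a vanishing link. The rotations of one representative share
    the same weight, whence the multiplicity [size (cycword c)]. A single [S] serves every [k] up to
    [N]. *)
Lemma trace_cycles (A : comNzRingType) (F : edge G -> edge G -> A) k N
    (S : seq (cyc G)) : (forall e e', ~~ follows e e' -> F e e' = 0) ->
    (0 < k <= N)%N -> uniq S -> (forall c, c \in S -> primitive c) ->
    (forall c, primitive c -> (size (cycword c) <= N)%N -> c \in S) ->
  \tr ((\matrix_(i, j < nedge G) F (enum_val i) (enum_val j)) ^+ k) =
  \sum_(c <- S | (size (cycword c) %| k)%N)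
    wweight F (cycword c) ^+ (k %/ size (cycword c)) *+ size (cycword c).
Proof.
move=> F0 k_int uS primS allS.
have := perm_circuits k_int uS primS allS; case/andP: k_int => k0 _.
case: k k0 => // k _ permS; rewrite trace_words.
rewrite (bigID (path.cycle (@follows _ G))) /= [X in _ + X]big1 ?addr0.
  rewrite -big_filter (perm_big _ permS) big_allpairs_dep big_filter.
  apply: eq_bigr => c dv.
  under eq_bigr do rewrite wweight_rot wweight_wpow.
  by rewrite big_const_seq count_predT size_iota iter_addr_0.
move=> w; rewrite cycle_links => /allPn[z zw /F0 Fz].
by rewrite /wweight (perm_big _ (perm_to_rem zw)) big_cons Fz /= mul0r.
Qed.

Lemma short_cycles N : exists S : seq (cyc G),
  [/\ uniq S, forall c, c \in S -> primitive c &
      forall c, primitive c -> (size (cycword c) <= N)%N -> c \in S].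
Proof.
pose ws := flatten [seq words (edge G) k | k <- iota 0 N.+1].
pose S := [seq \pi_(cyc G) x | x <- pmap (insub : _ -> option (circuit G)) ws].
exists (undup [seq c <- S | `[< primitive c >]]); split=> [|c|c prim le_cN].
- exact: undup_uniq.
- by rewrite mem_undup mem_filter => /andP[/asboolP].
rewrite mem_undup mem_filter asboolT //=; apply/mapP; exists (repr c).
  rewrite mem_pmap_sub; apply/flatten_mapP; exists (size (cycword c)).
    by rewrite mem_iota.
  by rewrite mem_words.
by rewrite reprK.
Qed.

End Cycles.

(** * The Euler product *)

Section EulerProduct.
Variables (K : fieldType) (G : wdigraph K).
Hypothesis char0 : forall k (c : K), c *+ k.+1 = 0 -> c = 0.
Notation edges := (edge (updown G)).

(** The entries of M over an arbitrary ring of coefficients, so that the same expression covers the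
    specializations of [t]. *)
Definition link_of (A : comNzRingType) (f : K -> A) (u : dir -> A)
    (t : dir -> dir -> A) (e e' : edges) : A :=
  if follows e e' then
    f (wt e) * (if reverse e e' then t (dirE e) (dirE e') else 1) * u (dirE e)
  else 0.

Definition link : edges -> edges -> tupoly K :=
  link_of (@cst K) (@uvar K) (fun d d' => tcst (tvar K d d')).

Lemma reverse_follows (H : wdigraph K) (e e' : edge H) :
  reverse e e' -> follows e e'.
Proof. by case/andP=> /eqP te _; rewrite /follows te. Qed.

(** A reversal is also a succession, so [mxC] already counts it with factor 1; the [mxB] terms, with
    coefficient t - 1, correct this factor to t. *)
Lemma link_matrix (A : idomainType) (f : K -> A) (u : dir -> A)
    (t : dir -> dir -> A) : f 0 = 0 ->
  u Up *: (map_mx f (mxC G Up) + (t Up Up - 1) *: map_mx f (mxB G Up Up)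
           + (t Up Dn - 1) *: map_mx f (mxB G Up Dn))
  + u Dn *: (map_mx f (mxC G Dn) + (t Dn Dn - 1) *: map_mx f (mxB G Dn Dn)
           + (t Dn Up - 1) *: map_mx f (mxB G Dn Up))
  = \matrix_(i, j) link_of f u t (enum_val i) (enum_val j).
Proof.
move=> f0; apply/matrixP => i j; rewrite !mxE /link_of /=.
move: (enum_val i) (enum_val j) => e e'; have := @reverse_follows _ e e'.
move: (wt_ud e) (follows e e') (reverse e e') (dirE e) (dirE e') => w.
by case=> [] [] [] [] //= rf; rewrite ?f0 ?(rf isT); try ring; have := rf isT.
Qed.

Lemma mxM_link : mxM G = \matrix_(i, j) link (enum_val i) (enum_val j).
Proof.
have cst0 : cst (0 : K) = 0 by rewrite /cst /tcst !mpolyC0.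
exact: (link_matrix (@uvar K) (fun d d' => tcst (tvar K d d')) cst0).
Qed.

Lemma prod_link_of (A : comNzRingType) (f : K -> A) (u : dir -> A)
    (t : dir -> dir -> A) (L : seq (edges * edges)) :
    {morph f : x y / x * y} -> f 1 = 1 -> all (fun z => follows z.1 z.2) L ->
  let b d d' := count (fun z : edges * edges =>
    [&& dirE z.1 == d, dirE z.2 == d' & reverse z.1 z.2]) L in
  let c d := count (fun z : edges * edges => dirE z.1 == d) L in
  \prod_(z <- L) link_of f u t z.1 z.2
  = f (\prod_(z <- L) wt z.1)
    * (t Up Up ^+ b Up Up * t Dn Dn ^+ b Dn Dn * t Up Dn ^+ b Up Dn
       * t Dn Up ^+ b Dn Up) * u Up ^+ c Up * u Dn ^+ c Dn.
Proof.
move=> fM f1; elim: L => [|[e e'] L IH] /=.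
  by move=> _; rewrite !big_nil f1 !mulr1.
move=> /andP[fol /IH{}IH]; rewrite !big_cons /= /link_of /= fol IH fM.
move: (wt_ud e) (reverse e e') (dirE e) (dirE e') => w.
by case=> [] [] [] /=; rewrite ?add0n ?add1n ?exprS;
  move: (_ ^+ _) (_ ^+ _) (_ ^+ _) (_ ^+ _) (_ ^+ _) (_ ^+ _) => *; ring.
Qed.

Lemma tcstM : {morph @tcst K : p q / p * q}.
Proof. exact: mpolyCM. Qed.

Lemma tcstX (p : tpoly K) k : tcst (p ^+ k) = tcst p ^+ k.
Proof. exact: rmorphXn. Qed.

Lemma cstM : {morph @cst K : x y / x * y}.
Proof. by move=> x y; rewrite /cst mpolyCM tcstM. Qed.

Lemma cst1 : cst (1 : K) = 1.
Proof. by rewrite /cst mpolyC1; apply: mpolyC1. Qed.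

Lemma wweight_link g : is_circuit g -> wweight link g = circuit_term g.
Proof.
case/andP=> _; rewrite cycle_links => fol.
have := prod_link_of (@uvar K) (fun d d' => tcst (tvar K d d'))
  cstM cst1 fol.
have def_g : g = unzip1 (links g) by rewrite unzip1_zip ?size_rot.
rewrite /circuit_term !tcstM !tcstX.
have -> : \prod_(e <- g) wt e = \prod_(z <- links g) wt z.1.
  by rewrite {1}def_g big_map.
have nE d : ndir d g = count (fun z => dirE z.1 == d) (links g).
  by rewrite /ndir {1}def_g count_map.
by rewrite !nE.
Qed.

Lemma fps_euler_link e e' :
  fps_euler (fps_of_mpoly (link e e')) = fps_of_mpoly (link e e').
Proof.
rewrite /link /link_of; case: ifP => _; last by rewrite raddf0 raddf0.
have [c ->] : exists c : tpoly K, cst (wt e) *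
    (if reverse e e' then tcst (tvar K (dirE e) (dirE e')) else 1) = c%:MP.
  case: ifP => _; last by exists (wt e)%:MP; rewrite mulr1.
  by exists ((wt e)%:MP * tvar K (dirE e) (dirE e')); rewrite mpolyCM.
exact: fps_euler_linear.
Qed.

Lemma tpoly_char0 k (p : tpoly K) : p *+ k.+1 = 0 -> p = 0.
Proof.
move=> p0; apply/mpolyP => m; have := congr1 (mcoeff m) p0.
by rewrite mcoeffMn mcoeff0 => /char0.
Qed.

Lemma zeta_euler_product :
  has_fps_prod (@primitive _ (updown G)) (@zeta_factor K G)
    (fps_of_mpoly (\det (1%:M - mxM G)))^-1.
Proof.
pose F e e' := fps_of_mpoly (link e e').
pose M : 'M[fps 2 (tpoly K)]_(nedge (updown G)) :=
  \matrix_(i, j) F (enum_val i) (enum_val j).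
have F0 e e' : ~~ follows e e' -> F e e' = 0.
  by move=> /negPf nf; rewrite /F /link /link_of nf raddf0.
have EM i j : fps_euler (M i j) = M i j by rewrite mxE fps_euler_link.
have DE : fps_of_mpoly (\det (1%:M - mxM G)) = \det (1%:M - M).
  rewrite -det_map_mx map_mxB map_scalar_mx rmorph1 mxM_link.
  by congr (\det (_ - _)); apply/matrixP => i j; rewrite !mxE.
have wF (c : cyc (updown G)) :
    wweight F (cycword c) = fps_of_mpoly (circuit_term (cycword c)).
  by rewrite -wweight_link ?cycword_circuit // /wweight rmorph_prod.
have Ex (c : cyc (updown G)) :
    fps_euler (wweight F (cycword c)) =
    wweight F (cycword c) *+ size (cycword c).
  rewrite /wweight fps_euler_prod ?size_links // => z.
  exact: fps_euler_link.
(* Cycles longer than [mdeg m] cannot affect the coefficient at [m], so [S0] consists of the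
   primitive cycles of length at most [mdeg m]. *)
move=> m; have [S0 [uS0 primS0 allS0]] := short_cycles (updown G) (mdeg m).
exists S0 => // S uS primS sub_S.
have trM k (lt_k : (k < mdeg m)%N) :=
  @trace_cycles _ (updown G) _ F k.+1 (mdeg m) S F0
    lt_k uS primS (fun c pc lc => sub_S _ (allS0 _ pc lc)).
have := fps_euler_product tpoly_char0 EM (@cycword_gt0 _ (updown G)) Ex trM.
rewrite -DE => /(_ m (ltnSn _)); rewrite fps_addE fps_oppE => /eqP.
rewrite subr_eq0 => /eqP <-.
congr (_ m); apply: eq_bigr => c _.
by rewrite wF.
Qed.

Lemma zetaV : (zeta G)^-1 = fps_of_mpoly (\det (1%:M - mxM G)).
Proof.
rewrite -[RHS]invrK; congr _^-1.
apply: has_fps_prod_unique zeta_euler_product.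
(* Convergence excludes the default value 0 of [fps_prod]. *)
apply: (xgetPex (0 : fps 2 (tpoly K))
  (P := [set z | has_fps_prod (@primitive _ (updown G))
                              (@zeta_factor K G) z]%classic)).
by eexists; apply: zeta_euler_product.
Qed.

End EulerProduct.

(** * Determinants of involutive perturbations *)

Section InvolutionDeterminant.
Variable A : comNzRingType.

(* Both sides are minors of the block matrix [[N, U], [V, 1]]: clear U with V
   or with N'. *)
Lemma det_sub_mulmx p n (N N' : 'M[A]_p) (U : 'M_(p, n)) (V : 'M_(n, p)) q :
  N *m N' = q%:M ->
  \det (N - U *m V) * q ^+ n = \det N * \det (q%:M - V *m N' *m U).
Proof.
move=> NN'; pose X := block_mx N U V 1%:M.
have -> : \det (N - U *m V) = \det X.
  rewrite -[RHS]mulr1 -(_ : \det (block_mx (1%:M : 'M_p) 0 (- V) 1%:M) = 1).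
    rewrite -det_mulmx mulmx_block !mulmx1 !mulmx0 !mul1mx !add0r.
    by rewrite mulmxN subrr det_ublock det1 mulr1.
  by rewrite det_lblock !det1 mulr1.
have -> : q ^+ n = \det (block_mx (1%:M : 'M_p) (- (N' *m U)) 0 q%:M).
  by rewrite det_ublock det1 mul1r det_scalar.
rewrite -det_mulmx mulmx_block !mulmx1 !mulmx0 !addr0 !mulmxN mulmxA NN'.
rewrite mul_scalar_mx mul_mx_scalar addNr det_lblock mul1mx mulmxA.
by rewrite addrC.
Qed.

(* Multiplying by the unipotent matrix 1 + (strict upper part of K) makes
   1 - K lower triangular. *)
Lemma det_sub_involution p (K : 'M[A]_p) (s : 'I_p -> 'I_p) :
    involutive s -> (forall i j, j != s i -> K i j = 0) ->
  \det (1%:M - K) = (\prod_(i | s i == i) (1 - K i i)) *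
    \prod_(i : 'I_p | (i < s i)%N) (1 - K i (s i) * K (s i) i).
Proof.
move=> sK K0; pose P := \matrix_(i, j) if (i < j)%N then K i j else 0.
have detP : \det (1%:M + P) = 1.
  rewrite -det_tr det_trig; first by
    apply: big1 => i _; rewrite !mxE eqxx ltnn addr0.
  apply/is_trig_mxP => i j lt_ij; rewrite !mxE [(j < i)%N]ltnNge ltnW // addr0.
  by rewrite -[j == i]/(j == i :> nat) gtn_eqF.
(* [P *m K] is diagonal: row i of [P] is supported at [s i], and row [s i] of [K] at i. *)
have PK i j : (P *m K) i j =
    if (i < s i)%N && (j == i) then K i (s i) * K (s i) i else 0.
  rewrite mxE (bigD1 (s i)) //= big1 ?addr0 => [|k ki]; last first.
    by rewrite mxE K0 // if_same mul0r.
  rewrite mxE; case: ifP => _; last by rewrite mul0r.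
  have [->//|ji] := eqVneq j i.
  by rewrite [K (s i) j]K0 ?mulr0 // sK.
rewrite -[LHS]mul1r -[X in X * _]detP -det_mulmx.
have QE i j : ((1%:M + P) *m (1%:M - K)) i j = (i == j)%:R - K i j + P i j
    - (if (i < s i)%N && (j == i) then K i (s i) * K (s i) i else 0).
  rewrite mulmxDl mul1mx mulmxBr mulmx1 -PK.
  by rewrite addrA !mxE.
rewrite det_trig; last first.
  apply/is_trig_mxP => i j lt_ij; rewrite QE !mxE lt_ij.
  rewrite -[i == j]/(i == j :> nat) -[j == i]/(j == i :> nat).
  by rewrite (gtn_eqF lt_ij) (ltn_eqF lt_ij) andbF sub0r addNr subr0.
have QiE i : ((1%:M + P) *m (1%:M - K)) i i =
    (if s i == i then 1 - K i i else 1) *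
    (if (i < s i)%N then 1 - K i (s i) * K (s i) i else 1).
  rewrite QE mxE ltnn addr0 eqxx andbT; have [si|si] := eqVneq (s i) i.
    by rewrite !si ltnn subr0 mulr1.
  rewrite (K0 i i) 1?eq_sym // subr0 mul1r.
  by case: ifP; rewrite ?subr0.
by rewrite (eq_bigr _ (fun i _ => QiE i)) big_split /= -!big_mkcond.
Qed.

Section OnFinType.
Variables (T : finType) (n : nat) (s : T -> T) (K : T -> T -> A).
Variables (hd tl : T -> 'I_n) (a c : T -> A) (q : A).
Hypotheses (sK : involutive s) (K0 : forall e e', e' != s e -> K e e' = 0).
Let kappa e := K e (s e) * K (s e) e.
Hypotheses (cE : forall e, c e = q + kappa e)
  (Kc : forall e, K e (s e) * (1 - c (s e)) = 0).

Definition mx_of (F : T -> T -> A) : 'M[A]_#|T| :=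
  \matrix_(i, j) F (enum_val i) (enum_val j).

Lemma sum_enum_val (H : T -> A) : \sum_(i < #|T|) H (enum_val i) = \sum_e H e.
Proof. exact/esym/big_enum_val. Qed.

Lemma det_mx_of_involution : \det (1%:M - mx_of K) =
  (\prod_(e | s e == e) (1 - K e e)) *
  \prod_(e | (enum_rank e < enum_rank (s e))%N) (1 - kappa e).
Proof.
pose r (i : 'I_#|T|) := enum_rank (s (enum_val i)).
rewrite (@det_sub_involution _ _ r).
- congr (_ * _).
    rewrite (reindex (@enum_rank T)) /=; last first.
      by apply: onW_bij; apply: enum_rank_bij.
    apply: eq_big => [e|e _]; last by rewrite !mxE !enum_rankK.
    by rewrite /r enum_rankK (inj_eq enum_rank_inj).
  rewrite (reindex (@enum_rank T)) /=; last first.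
    by apply: onW_bij; apply: enum_rank_bij.
  apply: eq_big => [e|e _]; first by rewrite /r enum_rankK.
  by rewrite !mxE /r !enum_rankK.
- by move=> i; rewrite /r enum_rankK sK enum_valK.
move=> i j; rewrite !mxE => ji; apply: K0; apply: contraNneq ji => js.
by rewrite /r -js enum_valK.
Qed.

(** The succession part factors as [U *m V], from edges to their heads and from vertices to the
    edges leaving them. The conditions [cE] and [Kc] say that [N'], the diagonal of [c] plus [K],
    satisfies (1 - K) N' = q, so [det_sub_mulmx] moves the determinant to the vertices. *)
Lemma det_involution_follows :
  \det (1%:M - mx_of (fun e e' => K e e' + (hd e == tl e')%:R * a e)) * q ^+ n =
  (\prod_(e | s e == e) (1 - K e e)) *
  (\prod_(e | (enum_rank e < enum_rank (s e))%N) (1 - kappa e)) *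
  \det (q%:M - \matrix_(v, v')
    (\sum_(e | (tl e == v) && (hd e == v')) c e * a e
     + \sum_(e | (tl e == v) && (hd (s e) == v')) K e (s e) * a (s e))).
Proof.
pose U : 'M[A]_(#|T|, n) := \matrix_(i, v)
  ((hd (enum_val i) == v)%:R * a (enum_val i)).
pose V : 'M[A]_(n, #|T|) := \matrix_(v, j) (tl (enum_val j) == v)%:R.
pose N' := mx_of (fun e e' => (e' == e)%:R * c e + K e e').
have -> : 1%:M - mx_of (fun e e' => K e e' + (hd e == tl e')%:R * a e) =
    (1%:M - mx_of K) - U *m V.
  apply/matrixP => i j; rewrite !mxE opprD addrA; congr (_ - _).
  rewrite (bigD1 (hd (enum_val i))) //= big1 ?addr0 => [|v vi].
    by rewrite !mxE eqxx mul1r mulrC [_ == tl _]eq_sym.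
  by rewrite !mxE eq_sym (negPf vi) !mul0r.
rewrite (@det_sub_mulmx _ _ _ N').
  rewrite det_mx_of_involution; congr (_ * \det (_ - _)).
  apply/matrixP => v v'; rewrite -mulmxA !mxE.
  have N'U e : \sum_k N' (enum_rank e) k * U k v' =
      c e * ((hd e == v')%:R * a e)
      + K e (s e) * ((hd (s e) == v')%:R * a (s e)).
    under eq_bigr do rewrite !mxE enum_rankK.
    rewrite (sum_enum_val (fun e' => ((e' == e)%:R * c e + K e e') *
      ((hd e' == v')%:R * a e'))).
    under eq_bigr do rewrite mulrDl; rewrite big_split /=; congr (_ + _).
      rewrite (bigD1 e) //= eqxx mul1r big1 ?addr0 // => e' /negPf->.
      by rewrite !mul0r.
    by rewrite (bigD1 (s e)) //= big1 ?addr0 // => e' /K0->; rewrite mul0r.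
  transitivity (\sum_e (tl e == v)%:R *
     (c e * ((hd e == v')%:R * a e)
      + K e (s e) * ((hd (s e) == v')%:R * a (s e)))).
    rewrite -sum_enum_val; apply: eq_bigr => i _.
    by rewrite [V _ _]mxE mxE -N'U enum_valK.
  rewrite [X in _ = X + _]big_mkcond [X in _ = _ + X]big_mkcond -big_split.
  apply: eq_bigr => e _ /=.
  by case: eqP => _; case: eqP => _; case: eqP => _;
    rewrite ?mul0r ?mul1r ?mulr0 ?addr0 ?add0r.
apply/matrixP => i j; rewrite mulmxBl mul1mx !mxE.
set e := enum_val i; set e' := enum_val j.
have -> : \sum_k mx_of K i k * N' k j =
    K e (s e) * ((e' == s e)%:R * c (s e) + K (s e) e').
  under eq_bigr do rewrite !mxE -/e -/e'.
  rewrite (sum_enum_val (fun x => K e x * ((e' == x)%:R * c x + K x e'))).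
  by rewrite (bigD1 (s e)) //= big1 ?addr0 // => x /K0->; rewrite mul0r.
have -> : (i == j) = (e' == e) by rewrite (inj_eq enum_val_inj) eq_sym.
rewrite mulrDr opprD [- _ + - _]addrC addrACA.
have -> : K e (s e) * K (s e) e' = (e' == e)%:R * kappa e.
  have [->|e'e] := eqVneq e' e; first by rewrite mul1r.
  by rewrite mul0r [K (s e) _]K0 ?mulr0 // sK.
have -> : K e e' - K e (s e) * ((e' == s e)%:R * c (s e)) = 0.
  have [->|e's] := eqVneq e' (s e); last by rewrite K0 // mul0r mulr0 subrr.
  by rewrite -(Kc e) mulrBr mulr1 mul1r.
by rewrite addr0 -mulrBr cE addrK mulr_natl.
Qed.

End OnFinType.
End InvolutionDeterminant.

(** * Reverse edges *)

(** Comparing ranks selects one element of each two-element orbit, and [s] carries the selected ones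
    onto the others. *)
Lemma card_ltn_involution (T : finType) (s : T -> T) : involutive s ->
  (#|[set e | (enum_rank e < enum_rank (s e))%N]| * 2)%N
  = #|[set e | s e != e]|.
Proof.
move=> sK; pose L := [set e | (enum_rank e < enum_rank (s e))%N].
pose L' := [set e | (enum_rank (s e) < enum_rank e)%N].
have -> : [set e | s e != e] = L :|: L'.
  apply/setP => e; rewrite !inE -neq_ltn.
  rewrite -[enum_rank e != _ :> nat]/(enum_rank e != enum_rank (s e)).
  by rewrite (inj_eq enum_rank_inj) eq_sym.
have -> : L' = s @: L.
  apply/setP => e; apply/idP/imsetP => [|[e' + ->]]; last by rewrite !inE sK.
  by rewrite inE => lt_e; exists (s e); rewrite ?inE ?sK.
rewrite cardsU disjoint_setI0 ?cards0 ?subn0.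
  by rewrite card_imset ?muln2 -?addnn //; apply: can_inj sK.
rewrite disjoint_sym; apply/pred0P => e /=; apply/negbTE/negP => /andP[].
by move=> /imsetP[e' + ->]; rewrite !inE sK => /ltn_trans h /h; rewrite ltnn.
Qed.

Section NonparallelEdges.
Variables (K : fieldType) (G : wdigraph K) (hG : nonparallel G).
Implicit Types e : edge G.
Local Notation head := (@Defs.head K G).

Lemma reverse_sym e e' : reverse e e' = reverse e' e.
Proof.
by rewrite /reverse andbC; congr (_ && _); apply: eq_sym.
Qed.

Lemma reverse_uniq e e1 e2 : reverse e e1 -> reverse e e2 -> e1 = e2.
Proof.
move=> /andP[/eqP t1 /eqP h1] /andP[/eqP t2 /eqP h2].
by apply: hG; rewrite t1 t2 h1 h2.
Qed.

Definition has_reverse e := [exists e', reverse e e'].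
(** The default [e] makes this an involution on all edges; loops are fixed as well, being their own
    reverses. *)
Definition rev_edge e := odflt e [pick e' | reverse e e'].

Lemma rev_edgeE e e' : reverse e e' -> rev_edge e = e'.
Proof.
move=> r; rewrite /rev_edge; case: pickP => [e'' r'|/(_ e')]; last by rewrite r.
exact: reverse_uniq r' r.
Qed.

Lemma reverse_rev_edge e : reverse e (rev_edge e) = has_reverse e.
Proof.
apply/idP/existsP => [r|[e' r]]; first by exists (rev_edge e).
by rewrite (rev_edgeE r).
Qed.

Lemma rev_edge_id e : ~~ has_reverse e -> rev_edge e = e.
Proof.
move=> nr; rewrite /rev_edge; case: pickP => // e' r.
by case/existsP: nr; exists e'.
Qed.

Lemma rev_edgeK : involutive rev_edge.
Proof.
move=> e; case: (boolP (has_reverse e)) => [|nr].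
  by rewrite -reverse_rev_edge reverse_sym => /rev_edgeE.
by rewrite !rev_edge_id.
Qed.

Lemma reverse_loop e : reverse e e = (tail e == head e).
Proof. by rewrite /reverse [head e == _]eq_sym andbb. Qed.

Lemma rev_edge_loop e : tail e = head e -> rev_edge e = e.
Proof. by move=> l; apply: rev_edgeE; rewrite reverse_loop l. Qed.

Lemma rev_edge_neq e :
  (rev_edge e != e) = has_reverse e && (tail e != head e).
Proof.
apply/idP/andP => [re|[]].
  split; first by apply: contraNT re => /rev_edge_id->.
  by apply: contraNneq re => /rev_edge_loop->.
by rewrite -reverse_rev_edge => r; apply: contraNneq => re;
   rewrite re reverse_loop in r.
Qed.

Lemma mxA_edge i j :
  mxA G i j = \sum_(e | (tail e == i) && (head e == j)) 1.
Proof.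
rewrite mxE; case: existsP => [[e /andP[/eqP te /eqP he]]|no_e].
  rewrite (bigD1 e) ?te ?he ?eqxx //= big1 ?addr0 // => e'.
  move=> /andP[/andP[/eqP te' /eqP he'] /eqP[]].
  by apply: hG; rewrite te he te' he'.
by rewrite big1 // => e te; case: no_e; exists e.
Qed.

Lemma sum_out i (H : edge G -> K) :
  \sum_j \sum_(e | (tail e == i) && (head e == j)) H e =
  \sum_(e | tail e == i) H e.
Proof. by rewrite [RHS](partition_big (head) xpredT). Qed.

Lemma sum_in j (H : edge G -> K) :
  \sum_i \sum_(e | (tail e == i) && (head e == j)) H e =
  \sum_(e | head e == j) H e.
Proof.
rewrite [RHS](partition_big (@tail _ G) xpredT) //; apply: eq_bigr => i _.
by apply: eq_bigl => e; rewrite andbC.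
Qed.

Lemma mxDoutE i j :
  mxDout G i j = \sum_(e | (tail e == i) && (tail e == j)) 1.
Proof.
rewrite !mxE; under eq_bigr do rewrite mxA_edge.
rewrite sum_out; have [<-|ij] := eqVneq i j.
  by apply: eq_bigl => e; rewrite andbb.
by rewrite mulr0n big1 // => e /andP[/eqP->]; rewrite (negPf ij).
Qed.

Lemma mxDinE i j :
  mxDin G i j = \sum_(e | (head e == i) && (head e == j)) 1.
Proof.
rewrite !mxE; under eq_bigr do rewrite mxE mxA_edge.
rewrite sum_in; have [<-|ij] := eqVneq i j.
  by apply: eq_bigl => e; rewrite andbb.
by rewrite mulr0n big1 // => e /andP[/eqP->]; rewrite (negPf ij).
Qed.

Lemma mxAsymE i j : mxAsym G i j =
  \sum_(e | (tail e == i) && (head e == j)) (has_reverse e)%:R.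
Proof.
rewrite mxE mxA_edge mulr_suml; apply: eq_bigr => e /andP[/eqP<- /eqP<-].
by rewrite mul1r mxE.
Qed.

Lemma mxDsymE i j : mxDsym G i j =
  \sum_(e | (tail e == i) && (tail e == j)) (has_reverse e)%:R.
Proof.
rewrite !mxE; under eq_bigr do rewrite mxAsymE.
rewrite sum_out; have [<-|ij] := eqVneq i j.
  by apply: eq_bigl => e; rewrite andbb.
by rewrite mulr0n big1 // => e /andP[/eqP->]; rewrite (negPf ij).
Qed.

Lemma mxWsymE i j : mxWsym G i j =
  \sum_(e | (tail e == i) && (head e == j)) (has_reverse e)%:R * wt e.
Proof.
rewrite mxE [mxW G i j]mxE mulr_sumr; apply: eq_bigr => e /andP[/eqP<- /eqP<-].
rewrite mxE mxA_edge (bigD1 e) ?eqxx //= big1 ?addr0 => [|e'].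
  by rewrite mul1r mxE.
by move=> /andP[/andP[/eqP te' /eqP he'] /eqP[]]; apply: hG; rewrite te' he'.
Qed.

Lemma sum_edges (H : edge G -> K) :
  \sum_i \sum_(e | (tail e == i) && (head e == i)) H e =
  \sum_(e | tail e == head e) H e.
Proof.
rewrite [RHS](partition_big (@tail _ G) xpredT) //; apply: eq_bigr => i _.
apply: eq_bigl => e; case: (eqVneq (tail e) i) => [->|]; rewrite ?andbF //.
by rewrite andbT eq_sym.
Qed.

Lemma mxtrace_mxA : \tr (mxA G) = #|[set e | tail e == head e]|%:R.
Proof.
rewrite /mxtrace; under eq_bigr do rewrite mxA_edge.
by rewrite sum_edges sumr_const cardsE.
Qed.

Lemma mxtrace_mxW : \tr (mxW G) = \sum_(e | tail e == head e) wt e.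
Proof. by rewrite /mxtrace; under eq_bigr do rewrite mxE; apply: sum_edges. Qed.

(** The trace is the sum of the entries of [mxAsym], which counts the edges possessing a reverse,
    loops included. *)
Lemma mxtrace_mxA2 : \tr (mxA G *m mxA G) = #|[set e | has_reverse e]|%:R.
Proof.
rewrite /mxtrace; under eq_bigr do rewrite mxE.
transitivity (\sum_i \sum_j mxAsym G i j).
  by apply: eq_bigr => i _; apply: eq_bigr => j _; rewrite [RHS]mxE.
under eq_bigr do under eq_bigr do rewrite mxAsymE.
under eq_bigr do rewrite sum_out.
transitivity (\sum_e (has_reverse e)%:R : K).
  by rewrite [RHS](partition_big (@tail _ G) xpredT).
rewrite -natr_sum -sum1_card [in RHS]big_mkcond /=; congr _%:R.
by apply: eq_bigr => e _; rewrite inE; case: has_reverse.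
Qed.

(** Each unordered pair is represented by its edge of smaller rank. *)
Lemma nrecip_lt :
  nrecip G = #|[set e | (enum_rank e < enum_rank (rev_edge e))%N]|.
Proof.
pose L := [set e | (enum_rank e < enum_rank (rev_edge e))%N].
have injL : {in L &, injective (fun e => [set e; rev_edge e])}.
  move=> e e'; rewrite !inE => le le' eq_e.
  have : e \in [set e'; rev_edge e'] by rewrite -eq_e set21.
  rewrite !inE => /orP[/eqP//|/eqP def_e].
  by move: le; rewrite def_e rev_edgeK ltnNge ltnW.
rewrite /nrecip -(card_in_imset injL); apply: eq_card => X.
apply/imsetP/imsetP => [[[e e'] /=]|[e]]; rewrite inE /=.
  move=> /andP[r nl] ->; have re := rev_edgeE r.
  have : rev_edge e != e by rewrite rev_edge_neq nl -reverse_rev_edge re r.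
  rewrite re -(inj_eq enum_rank_inj).
  rewrite -[_ != _]/(enum_rank e' != enum_rank e :> nat).
  rewrite neq_ltn => /orP[lt_e|lt_e].
    exists e'; first by rewrite inE -re rev_edgeK re.
    by rewrite -re rev_edgeK re finset.setUC.
  by exists e; rewrite ?inE re.
move=> le ->; exists (e, rev_edge e) => //; rewrite inE /=.
rewrite reverse_rev_edge -rev_edge_neq.
by apply: contraTneq le => ->; rewrite ltnn.
Qed.

Lemma nrecip_double :
  (nrecip G * 2)%N = #|[set e | has_reverse e && (tail e != head e)]|.
Proof.
rewrite nrecip_lt (card_ltn_involution rev_edgeK).
by apply: eq_card => e; rewrite !inE rev_edge_neq.
Qed.

Lemma card_has_reverse : #|[set e | has_reverse e]| =
  (nrecip G * 2 + #|[set e | tail e == head e]|)%N.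
Proof.
rewrite nrecip_double -(cardsID [set e | tail e != head e]); congr (_ + _)%N.
  by apply: eq_card => e; rewrite !inE andbC.
apply: eq_card => e; rewrite !inE negbK; case: eqP => // l.
by rewrite -reverse_rev_edge rev_edge_loop // reverse_loop l eqxx.
Qed.

End NonparallelEdges.

(** * Determinant formulas over the vertices *)

Section DeterminantFormulas.
Variables (K : fieldType) (G : wdigraph K) (hG : nonparallel G).
Variables (A : comNzRingType) (f : {rmorphism K -> A}).
Variables (u : dir -> A) (t : dir -> dir -> A).
Notation edges := (edge (updown G)).
Local Notation head := (@Defs.head K G).
Local Notation hd := (@Defs.head K (updown G)).
Local Notation tl := (@tail K (updown G)).

Let a (e : edges) := f (wt e) * u (dirE e).
Let back (e e' : edges) :=
  if reverse e e' then a e * (t (dirE e) (dirE e') - 1) else 0.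

(** Splits M into the succession part, which factors through the vertices, and the corrections at
    reversals. Each specialization of [t] confines the latter to the graph of an involution. *)
Lemma link_of_back :
  mx_of (@link_of K G A f u t) =
  mx_of (fun e e' => back e e' + (hd e == tl e')%:R * a e).
Proof.
apply/matrixP => i j; rewrite !mxE /link_of /back.
move: (enum_val i) (enum_val j) => e e'; have := @reverse_follows _ _ e e'.
rewrite /follows /a; case: reverse => [/(_ isT)->|_].
  by rewrite mul1r; ring.
by case: ifP => _; rewrite ?mul0r ?mulr1 ?mul1r add0r.
Qed.

Lemma big_updown (R : Type) (idx : R) (op : Monoid.com_law idx)
    (H : edges -> R) :
  \big[op/idx]_e H e =
  \big[op/idx]_(e : edge G) op (H (e, Up) : R) (H (e, Dn)).
Proof.
transitivity (\big[op/idx]_(p : edge G * dir) H (p.1, p.2)).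
  by apply: eq_bigr => -[].
rewrite -(pair_bigA _ (fun (e : edge G) (d : dir) => H (e, d))) /=.
apply: eq_bigr => e _.
rewrite (bigD1 Up) //= (bigD1 Dn) //= big1 ?Monoid.mulm1 //.
by case.
Qed.

Lemma card_dir : #|{: dir}| = 2%N.
Proof.
by rewrite -sum1_card (bigD1 Up) //= (bigD1 Dn) //= big1 //; case.
Qed.

Lemma map_mxWE i j : f (mxW G i j) =
  \sum_e (if (tail e == i) && (head e == j) then f (wt e) else 0).
Proof. by rewrite mxE rmorph_sum -big_mkcond. Qed.

Lemma map_mxWstarE i j : f (mxWstar G i j) =
  \sum_e (if (head e == i) && (tail e == j) then f (wt e)^-1 else 0).
Proof. by rewrite mxE rmorph_sum -big_mkcond. Qed.

Lemma map_sumE (P : pred (edge G)) (H : edge G -> K) :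
  f (\sum_(e | P e) H e) = \sum_e (if P e then f (H e) else 0).
Proof. by rewrite rmorph_sum -big_mkcond. Qed.

Lemma rmorph_wtV (e : edge G) : f (wt e) * f (wt e)^-1 = 1.
Proof. by rewrite -rmorphM mulfV ?wt_neq0 // rmorph1. Qed.

Lemma scalar_sub_matrixE n (q : A) (F : 'I_n -> 'I_n -> A) i j :
  (q%:M - \matrix_(v, v') F v v') i j = q *+ (i == j) - F i j.
Proof. by rewrite !mxE. Qed.

Lemma mixed_matrixE n (q c1 c2 c3 c4 : A) (M1 M2 M3 M4 : 'M[K]_n) i j :
  (q%:M - c1 *: map_mx f M1 - c2 *: map_mx f M2 - c3 *: map_mx f M3
     - c4 *: map_mx f M4) i j =
  q *+ (i == j) - c1 * f (M1 i j) - c2 * f (M2 i j) - c3 * f (M3 i j)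
     - c4 * f (M4 i j).
Proof. by rewrite !mxE. Qed.

Lemma up_matrixE n (q c1 c2 c3 c4 : A) (M1 M2 M3 M4 : 'M[K]_n) i j :
  (q%:M - q *: (c1 *: map_mx f M1 + c2 *: map_mx f M2) - c3 *: map_mx f M3
     - c4 *: map_mx f M4) i j =
  q *+ (i == j) - q * (c1 * f (M1 i j) + c2 * f (M2 i j)) - c3 * f (M3 i j)
     - c4 * f (M4 i j).
Proof. by rewrite !mxE. Qed.

(** The involution exchanges an edge with its added reverse. Their weights cancel, so every orbit
    product equals [s_up * s_dn], which allows [c = 1]; there are no fixed points and one orbit per
    edge of [G]. *)
Lemma det_link_mixed : t Up Up = 1 -> t Dn Dn = 1 ->
  let s_up := u Up * (t Up Dn - 1) in
  let s_dn := u Dn * (t Dn Up - 1) in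
  let q := 1 - s_up * s_dn in
  \det (1%:M - mx_of (@link_of K G A f u t)) * q ^+ nvert G =
  q ^+ nedge G * \det (q%:M - u Up *: map_mx f (mxW G)
     - u Dn *: map_mx f (mxWstar G) - (s_up * u Dn) *: map_mx f (mxDout G)
     - (s_dn * u Up) *: map_mx f (mxDin G)).
Proof.
move=> tU tD s_up s_dn q; rewrite link_of_back.
pose flip d := if d is Up then Dn else Up.
pose s (e : edges) : edges := (e.1, flip e.2).
have sK : involutive s by case=> e [].
have s_neq e : s e != e by case: e => e []; apply/eqP; case.
have rev_s e : reverse e (s e).
  by case: e => e []; rewrite /reverse /= /tail_ud /head_ud /= !eqxx.
(* A reversal with change of direction joins copies of edges with equal tail and head in [G], hence
   of the same edge. *)
have back0 e e' : e' != s e -> back e e' = 0.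
  case: e e' => [e d] [e' d']; rewrite /back; case: ifP => // r.
  case: d d' r => [] [] r; rewrite /= ?tU ?tD ?subrr ?mulr0 //;
    case/negP; apply/eqP; congr (_, _); apply: hG;
    move: r; rewrite /reverse /= /tail_ud /head_ud /=;
    by move=> /andP[/eqP-> /eqP->].
have backE e : back e (s e) = a e * (t (dirE e) (dirE (s e)) - 1).
  by rewrite /back rev_s.
have kE e : back e (s e) * back (s e) e = s_up * s_dn.
  have := backE (s e); rewrite sK => ->; rewrite backE /a /s_up /s_dn.
  by case: e => e []; rewrite /= /wt_ud /=; ring: (rmorph_wtV e).
rewrite (@det_involution_follows _ _ _ s back hd tl a (fun=> 1)) //; first last.
- by move=> e; rewrite subrr mulr0.
- by move=> e; rewrite kE subrK.
rewrite big1 ?mul1r => [|e /eqP se]; last by move: (s_neq e); rewrite se eqxx.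
congr (_ * _); last congr (\det _).
  under eq_bigr do rewrite kE.
  rewrite prodr_const -cardsE; congr (_ ^+ _); apply/eqP.
  rewrite -(eqn_pmul2r (isT : (0 < 2)%N)).
  rewrite (card_ltn_involution sK) (eq_card (B := edges)) => [|e].
    by rewrite card_prod card_dir.
  by rewrite inE s_neq.
apply/matrixP => i j; rewrite scalar_sub_matrixE mixed_matrixE.
rewrite (mxDoutE hG) (mxDinE hG).
rewrite !map_sumE rmorph1 map_mxWE map_mxWstarE -!addrA; congr (_ + _).
rewrite -!opprD; congr (- _); rewrite addrA; congr (_ + _).
  rewrite !mulr_sumr -big_split [LHS]big_mkcond big_updown.
  apply: eq_bigr => e _; rewrite /= /a /= /wt_ud /tail_ud /head_ud /=.
  by do 2!case: ifP => _; ring.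
(* Going along [e] and back along [s e] returns to the tail of [e]: [Up] edges give [mxDout], [Dn]
   edges give [mxDin]. *)
rewrite !mulr_sumr -big_split [LHS]big_mkcond big_updown.
apply: eq_bigr => e _.
rewrite !backE /a /s_up /s_dn /= /wt_ud /tail_ud /head_ud /=.
by do 2!case: ifP => _; ring: (rmorph_wtV e).
Qed.

(** The involution exchanges mutually reverse edges of [G] and fixes all added edges. Loops of
    weight 1 and -1 give the factors 1 - s and 1 + s, and each pair of reverse edges gives 1 -
    s^2. *)
Lemma det_link_up : reciprocal G -> (forall k, k.+1%:R != 0 :> K) ->
  t Dn Dn = 1 -> t Up Dn = 1 -> t Dn Up = 1 ->
  let s := u Up * (t Up Up - 1) in
  let q := 1 - s ^+ 2 in
  \det (1%:M - mx_of (@link_of K G A f u t)) * q ^+ nvert G =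
  (1 - s) ^+ nloop G 1 * (1 + s) ^+ nloop G (-1) * q ^+ nrecip G *
  \det (q%:M - q *: (u Up *: map_mx f (mxW G) + u Dn *: map_mx f (mxWstar G))
     - (s * u Up) *: map_mx f (mxDsym G)
     - (s ^+ 2 * u Up) *: map_mx f (mxWsym G)).
Proof.
move=> recG char0 tDD tUD tDU s q; rewrite link_of_back.
pose r (e : edges) : edges := if e.2 is Up then (rev_edge e.1, Up) else e.
have rK : involutive r by case=> e [] //; rewrite /r /= rev_edgeK.
have backE e : back e (r e) =
    if e.2 is Up then (has_reverse e.1)%:R * (f (wt e.1) * s) else 0.
  case: e => e []; rewrite /back /r /=.
    rewrite -(reverse_rev_edge hG).
    rewrite -[@reverse _ (updown G) _ _]/(reverse e (rev_edge e)).
    by case: reverse; rewrite ?mul0r // mul1r /s mulrA.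
  by rewrite tDD subrr mulr0 if_same.
have back0 e e' : e' != r e -> back e e' = 0.
  case: e e' => [e d] [e' d']; rewrite /back; case: ifP => // rev.
  case: d d' rev => [] [] rev; rewrite /= ?tDD ?tUD ?tDU ?subrr ?mulr0 //.
  by rewrite /r /= (rev_edgeE hG rev) eqxx.
have wr (e : edge G) : has_reverse e -> f (wt e) * f (wt (rev_edge e)) = 1.
  by rewrite -(reverse_rev_edge hG) => /recG->; rewrite rmorph_wtV.
have hrr (e : edge G) : has_reverse (rev_edge e) = has_reverse e.
  by rewrite -!(reverse_rev_edge hG) (rev_edgeK hG) reverse_sym.
have kE e : back e (r e) * back (r e) e =
    if e.2 is Up then (has_reverse e.1)%:R * s ^+ 2 else 0.
  have := backE (r e); rewrite rK => ->; rewrite backE.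
  case: e => e [] /=; last by rewrite mulr0.
  rewrite hrr; case: (boolP (has_reverse e)) => [h|]; last by rewrite !mul0r.
  by rewrite !mul1r mulrACA (wr e h) mul1r expr2.
(* By reciprocity the orbit product is s^2 on edges of [G] with a reverse and 0 elsewhere, so [c] is
   1 on the former and [q] on all others. *)
pose c (e : edges) := q + back e (r e) * back (r e) e.
rewrite (@det_involution_follows _ _ _ r back hd tl a c) //; last first.
  move=> e; rewrite /c rK [back (r e) e * _]mulrC kE backE.
  case: e => e []; last by rewrite mul0r.
  by rewrite /q; case: has_reverse; rewrite ?mul0r //=; ring.
congr (_ * _); last congr (\det _).
  congr (_ * _).
    have powE (P : pred (edge G)) (x : A) :
        x ^+ #|[set e | P e]| = \prod_e (if P e then x else 1).
      by rewrite cardsE -prodr_const big_mkcond.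
    rewrite big_mkcond big_updown /nloop !powE -big_split.
    apply: eq_bigr => e _; rewrite /= eqxx.
    have backD : back (e, Dn) (e, Dn) = 0 by rewrite -[RHS](backE (e, Dn)).
    rewrite backD subr0 mulr1 [r _ == _]xpair_eqE eqxx andbT.
    have := rev_edge_neq hG e; have [re|_] := eqVneq; last first.
      by move/esym/andP=> [_ /negPf->]; rewrite mulr1.
    have := backE (e, Up); rewrite /r /= re => -> /esym/negbT.
    rewrite negb_and negbK; case: eqP => [l _|_]; last first.
      by rewrite orbF => /negPf->; rewrite mul0r subr0 mulr1.
    have rl : reverse e e by rewrite reverse_loop l.
    have -> : has_reverse e by apply/existsP; exists e.
    (* A loop is its own reverse, so its weight is 1 or -1; these differ, so each loop enters
       exactly one of the two counts. *)
    have : wt e ^+ 2 == 1 by rewrite expr2 {2}(recG _ _ rl) mulfV ?wt_neq0.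
    have m1 : (-1 == 1 :> K) = false.
      by apply/negbTE; rewrite -subr_eq0 -opprD oppr_eq0 (char0 1%N).
    rewrite sqrf_eq1 => /orP[] /eqP->; rewrite eqxx ?m1 1?eq_sym ?m1.
      by rewrite (rmorph1 f) !mul1r mulr1.
    by rewrite (rmorphN1 f) !mul1r mulN1r opprK.
  have fE e : (enum_rank e < enum_rank (r e))%N ->
      1 - back e (r e) * back (r e) e = q.
    rewrite kE; case: e => e []; last by rewrite ltnn.
    move=> lt_e; have : rev_edge e != e.
      by apply: contraTneq lt_e => re; rewrite /r /= re ltnn.
    by rewrite rev_edge_neq // => /andP[-> _]; rewrite mul1r.
  rewrite (eq_bigr _ fE) prodr_const -cardsE; congr (_ ^+ _); apply/eqP.
  rewrite -(eqn_pmul2r (isT : (0 < 2)%N)).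
  rewrite (card_ltn_involution rK) (nrecip_double hG) -!sum1_card.
  rewrite big_mkcond big_updown [X in _ == X]big_mkcond; apply/eqP.
  apply: eq_bigr => e _; rewrite !inE -rev_edge_neq //.
  rewrite [r (e, Up) == _]xpair_eqE.
  by rewrite (_ : r (e, Dn) = (e, Dn)) // !eqxx andbT /= addn0.
apply/matrixP => i j; rewrite scalar_sub_matrixE up_matrixE.
rewrite (mxDsymE hG) (mxWsymE hG).
rewrite !map_sumE map_mxWE map_mxWstarE -!addrA; congr (_ + _).
rewrite -!opprD; congr (- _); rewrite [X in _ = _ + X]addrC addrA.
congr (_ + _).
  (* On edges with a reverse [c] is 1 = q + s^2; the excess over [q] produces [mxWsym]. *)
  rewrite !mulr_sumr -big_split mulr_sumr -big_split [LHS]big_mkcond.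
  rewrite big_updown; apply: eq_bigr => e _; rewrite /c !kE /a.
  rewrite /= /wt_ud /tail_ud /head_ud /= rmorphM rmorph_nat.
  by do 2!case: ifP => _; ring.
(* An edge followed by its reverse returns to its tail with weight 1, which produces [mxDsym]. *)
rewrite mulr_sumr [LHS]big_mkcond big_updown; apply: eq_bigr => e _.
rewrite !backE /= mul0r if_same addr0 /a /= /wt_ud /tail_ud /head_ud /=.
rewrite rmorph_nat; case: (boolP (has_reverse e)) => [h|_]; last first.
  by rewrite !mul0r !if_same mulr0.
have -> : head (rev_edge e) = tail e.
  by move: h; rewrite -(reverse_rev_edge hG) => /andP[_ /eqP].
by case: ifP => _; [ring: (wr e h) | ring].
Qed.

End DeterminantFormulas.

(** * Specialization of the variables, loop counts and passage to fractions *)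

Lemma rmorph_det_link (K : fieldType) (G : wdigraph K) (A B : comNzRingType)
    (g : {rmorphism A -> B}) (f : K -> A) (u : dir -> A) (t : dir -> dir -> A)
    (f' : K -> B) (u' : dir -> B) (t' : dir -> dir -> B) :
  (forall w, g (f w) = f' w) -> (forall d, g (u d) = u' d) ->
  (forall d d', g (t d d') = t' d d') ->
  g (\det (1%:M - mx_of (@link_of K G A f u t))) =
  \det (1%:M - mx_of (@link_of K G B f' u' t')).
Proof.
move=> gf gu gt.
rewrite -det_map_mx map_mxB map_scalar_mx rmorph1; congr (\det (_ - _)).
apply/matrixP => i j; rewrite !mxE /link_of -gf -gu -gt.
case: follows; last exact: rmorph0.
by rewrite /= !rmorphM; case: reverse; rewrite ?rmorph1.
Qed.

(** Treats [c = 1] and [c = -1] together: a loop of weight [c] contributes 1 + c^2 = 2, one of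
    weight [-c] contributes 1 - c^2 = 0. *)
Lemma trace_loops (K : fieldType) (G : wdigraph K) (c : K) :
  nonparallel G -> reciprocal G -> (2%:R != 0 :> K) -> c ^+ 2 = 1 ->
  \tr (mxA G) + c * \tr (mxW G) = (nloop G c)%:R * 2%:R.
Proof.
have cardE (P : pred (edge G)) : #|[set e | P e]|%:R = \sum_e (P e)%:R :> K.
  rewrite -sum1_card natr_sum big_mkcond; apply: eq_bigr => e _.
  by rewrite inE; case: (P e).
move=> hG recG nz2 c2; rewrite mxtrace_mxA // mxtrace_mxW /nloop !cardE.
rewrite [X in c * X]big_mkcond mulr_sumr mulr_suml -big_split.
apply: eq_bigr => e _ /=; case: eqP => [l|_]; last by rewrite mulr0 addr0 mul0r.
have rl : reverse e e by rewrite reverse_loop l.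
have : wt e ^+ 2 == c ^+ 2 by rewrite c2 expr2 {2}(recG _ _ rl) mulfV ?wt_neq0.
have [->|nc] := eqVneq (wt e) c; first by rewrite -expr2 c2 mul1r.
by rewrite eqf_sqr (negPf nc) => /eqP->; rewrite mulrN -expr2 c2 subrr mul0r.
Qed.

Section Specialization.
Variable K : fieldType.

Fact cst_is_zmod_morphism : zmod_morphism (@cst K).
Proof. by move=> x y; rewrite /cst mpolyCB; apply: mpolyCB. Qed.

Fact cst_is_monoid_morphism : monoid_morphism (@cst K).
Proof. by split; [apply: cst1 | apply: cstM]. Qed.

HB.instance Definition _ := GRing.isZmodMorphism.Build
  K (tupoly K) (@cst K) cst_is_zmod_morphism.
HB.instance Definition _ := GRing.isMonoidMorphism.Build
  K (tupoly K) (@cst K) cst_is_monoid_morphism.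

Lemma comp_mpoly_tvar (a : 4.-tuple (tpoly K)) d d' :
  comp_mpoly a (tvar K d d') = a`_(match d, d' with
    | Up, Up => 0 | Dn, Dn => 1 | Up, Dn => 2 | Dn, Up => 3 end)%N.
Proof. by case: d d' => [] []; rewrite /tvar comp_mpolyXU inordK. Qed.

Lemma tsubst_cst (a : 4.-tuple (tpoly K)) (w : K) : tsubst a (cst w) = cst w.
Proof.
by rewrite /tsubst /cst map_mpolyC; congr mpolyC; apply: comp_mpolyC.
Qed.

Lemma tsubst_det (G : wdigraph K) (a : 4.-tuple (tpoly K)) :
  tsubst a (\det (1%:M - mxM G)) = \det (1%:M - mx_of (@link_of K G (tupoly K)
    (@cst K) (@uvar K) (fun d d' => tcst (comp_mpoly a (tvar K d d'))))).
Proof.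
rewrite mxM_link; apply: (rmorph_det_link G
  (g := map_mpoly (comp_mpoly a) : {rmorphism tupoly K -> tupoly K})).
- exact: tsubst_cst.
- by move=> d; apply: map_mpolyX.
- by move=> d d'; apply: map_mpolyC.
Qed.

(** The value at u = 0 is 1. This makes the base of the possibly negative powers invertible among
    fractions. *)
Lemma sub1_uvar_neq0 (d : dir) (p : tupoly K) : 1 - uvar K d * p != 0.
Proof.
apply/eqP => /(congr1 (meval (fun=> 0))) /eqP.
rewrite mevalB mevalM meval1 /uvar mevalXU mul0r subr0 meval0.
by rewrite oner_eq0.
Qed.

(** Turns a polynomial identity, with the power of [q] cleared, into the formula whose exponent may
    be negative. *)
Lemma tofrac_exprz (A : idomainType) (Z q c D : A) (m n : nat) : q != 0 ->
  Z * q ^+ n = c * q ^+ m * D ->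
  tofrac Z = tofrac c * tofrac q ^ (m%:Z - n%:Z) * tofrac D.
Proof.
move=> q0 ZD; have Fq0 : tofrac q != 0 by rewrite tofrac_eq0.
apply: (mulIf (expf_neq0 n Fq0)).
have := congr1 (@tofrac A) ZD; rewrite !tofracM !tofracXn => ->.
rewrite [RHS]mulrAC; congr (_ * _); rewrite -[RHS]mulrA; congr (_ * _).
by rewrite !exprnP -expfzDr // subrK.
Qed.

End Specialization.

Theorem theorem7 (R : realType) (G : wdigraph R[i]) (hG : nonparallel G) :
  exists Zinv : tupoly R[i],
  [/\ (zeta G)^-1 = fps_of_mpoly Zinv,
      Zinv = \det (1%:M - mxM G),
      reciprocal G ->
        let u := @uvar R[i] in
        let t d d' := @tvar R[i] d d' in
        let s_up := u Up * (tcst (t Up Dn) - 1) in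
        let s_dn := u Dn * (tcst (t Dn Up) - 1) in
        tofrac (tsubst [tuple 1; 1; t Up Dn; t Dn Up] Zinv)
        = tofrac (1 - s_up * s_dn) ^ ((nedge G)%:Z - (nvert G)%:Z)
          * tofrac (\det ((1 - s_up * s_dn)%:M
                          - u Up *: map_mx (@cst R[i]) (mxW G)
                          - u Dn *: map_mx (@cst R[i]) (mxWstar G)
                          - (s_up * u Dn) *: map_mx (@cst R[i]) (mxDout G)
                          - (s_dn * u Up) *: map_mx (@cst R[i]) (mxDin G))) &
      reciprocal G ->
        let u := @uvar R[i] in
        let t d d' := @tvar R[i] d d' in
        let s := u Up * (tcst (t Up Up) - 1) in
        [/\ (nloop G 1)%:R = \tr (mxA G + mxW G) / 2,
            (nloop G (-1))%:R = \tr (mxA G - mxW G) / 2,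
            (nrecip G)%:R = (\tr (mxA G *m mxA G) - \tr (mxA G)) / 2 &
            tofrac (tsubst [tuple t Up Up; 1; 1; 1] Zinv)
            = tofrac (1 - s) ^+ nloop G 1 * tofrac (1 + s) ^+ nloop G (-1)
              * tofrac (1 - s ^+ 2) ^ ((nrecip G)%:Z - (nvert G)%:Z)
              * tofrac (\det ((1 - s ^+ 2)%:M
                  - (1 - s ^+ 2) *: (u Up *: map_mx (@cst R[i]) (mxW G)
                                     + u Dn *: map_mx (@cst R[i]) (mxWstar G))
                  - (s * u Up) *: map_mx (@cst R[i]) (mxDsym G)
                  - (s ^+ 2 * u Up) *: map_mx (@cst R[i]) (mxWsym G)))]].
Proof.
have natr_neq0 k : k.+1%:R != 0 :> R[i] by rewrite Num.Theory.pnatr_eq0.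
have char0 k (c : R[i]) : c *+ k.+1 = 0 -> c = 0.
  by move/eqP; rewrite Num.Theory.mulrn_eq0 => /eqP.
exists (\det (1%:M - mxM G)); split=> //.
- exact: zetaV.
- move=> _ u t s_up s_dn; rewrite tsubst_det.
  set T := fun d d' => tcst _.
  have TU : T Up Up = 1 by rewrite /T comp_mpoly_tvar; apply: mpolyC1.
  have TD : T Dn Dn = 1 by rewrite /T comp_mpoly_tvar; apply: mpolyC1.
  have TUD : T Up Dn = tcst (t Up Dn) by rewrite /T comp_mpoly_tvar.
  have TDU : T Dn Up = tcst (t Dn Up) by rewrite /T comp_mpoly_tvar.
  have := @det_link_mixed _ G hG (tupoly R[i]) (@cst R[i]) u T TU TD.
  rewrite TUD TDU => eq_det.
  (* No fixed points occur here, so the prefactor [c] of [tofrac_exprz] is taken to be 1. *)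
  rewrite -[tofrac _ ^ _]mul1r -[X in X * _ * _](tofrac1 (tupoly R[i])).
  apply: tofrac_exprz; first by rewrite -mulrA sub1_uvar_neq0.
  by rewrite mul1r; apply: eq_det.
move=> recG u t s.
split.
- apply: (mulIf (natr_neq0 1%N)).
  rewrite divfK ?natr_neq0 // mxtraceD -[\tr (mxW G)]mul1r.
  by rewrite (trace_loops hG recG (natr_neq0 1%N) (expr1n _ _)).
- apply: (mulIf (natr_neq0 1%N)).
  rewrite divfK ?natr_neq0 // mxtraceD -[- mxW G]scaleN1r mxtraceZ.
  have m1 : (-1) ^+ 2 = 1 :> R[i] by rewrite sqrrN expr1n.
  by rewrite (trace_loops hG recG (natr_neq0 1%N) m1).
- apply: (mulIf (natr_neq0 1%N)); rewrite divfK ?natr_neq0 //.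
  rewrite mxtrace_mxA2 // mxtrace_mxA // card_has_reverse //.
  by rewrite natrD addrK natrM.
rewrite tsubst_det.
set T := fun d d' => tcst _.
have TD : T Dn Dn = 1 by rewrite /T comp_mpoly_tvar; apply: mpolyC1.
have TUD : T Up Dn = 1 by rewrite /T comp_mpoly_tvar; apply: mpolyC1.
have TDU : T Dn Up = 1 by rewrite /T comp_mpoly_tvar; apply: mpolyC1.
have TU : T Up Up = tcst (t Up Up) by rewrite /T comp_mpoly_tvar.
have := @det_link_up _ G hG (tupoly R[i]) (@cst R[i]) u T recG natr_neq0
  TD TUD TDU.
rewrite TU => eq_det.
rewrite -[tofrac (1 - s) ^+ _]tofracXn -[tofrac (1 + s) ^+ _]tofracXn.
rewrite -[X in X * _ * _]tofracM.
apply: tofrac_exprz; last exact: eq_det.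
by rewrite expr2 {1}/s -!mulrA sub1_uvar_neq0.
Qed.
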